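(* Fix an integer $d\in2\mathbb{Z}_{>0}$. There exist only finitely many spectral types of fundamental admissible integrable families of dimension $d$.
   Context: **HTL normal forms.** A (unramified) HTL normal form of size $n$ is $B=\mathrm{diag}(q_1(z^{-1})I_{n_1}+R_1z^{-1},\ldots,q_m(z^{-1})I_{n_m}+R_mz^{-1})$ with $n_1+\cdots+n_m=n$, $n_j\ge1$, pairwise distinct $q_j(z^{-1})\in z^{-2}\mathbb{C}[z^{-1}]$ and $R_j\in M(n_j,\mathbb{C})$. The gauge action is $X[A]=XAX^{-1}+\frac{dX}{dz}X^{-1}$. **Moduli space.** For a collection $\mathbf{B}=(B^{(i)})_{0\le i\le p}$ of HTL normal forms of size $n$ (with $p\ge 0$ and $n\geq 1$ arbitrary), write $B^{(i)}=\mathrm{diag}(q^{(i)}_j(z^{-1})I_{n^{(i)}_j}+R^{(i)}_jz^{-1})_{1\le j\le m^{(i)}}$, let $k_i$ be the pole order of $B^{(i)}$, and $a_0=\infty,a_1,\ldots,a_p\in\mathbb{P}^1$ distinct points, with local coordinates $z_0=1/z$, $z_i=z-a_i$. The truncated orbit $\mathcal{O}^{\mathrm{tru}}_{B^{(i)}}$ is the orbit of the class of $B^{(i)}$ under conjugation by $\mathrm{GL}(n,\mathbb{C}[[z]])$ in $M(n,\mathbb{C}((z))/\mathbb{C}[[z]])$. $\mathfrak{M}(\mathbf{B})$ is the set of $\mathrm{GL}(n,\mathbb{C})$-classes of stable meromorphic connections $(\mathcal{O}^n,\nabla)$ on the trivial bundle over $\mathbb{P}^1$ with poles of order at most $k_i$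 at $a_i$ and no others, such that the polar part at $a_i$ lies in $\mathcal{O}^{\mathrm{tru}}_{B^{(i)}}$. Stable means that no subbundle $W\otimes\mathcal{O}$, $0\neq W\subsetneq\mathbb{C}^n$, is preserved by $\nabla$. **Quiver data $(\mathsf{Q},\lambda,\alpha)$.** Choose $\xi^{[i,j]}_1,\ldots,\xi^{[i,j]}_{e_{[i,j]}}\in\mathbb{C}$ with $\prod_k(R^{(i)}_j-\xi^{[i,j]}_k)=0$ and $e_{[i,j]}$ minimal. Put $I_{\mathrm{irr}}=\{i\mid m^{(i)}>1\}\cup\{0\}$, $I_{\mathrm{reg}}=\{0,\ldots,p\}\setminus I_{\mathrm{irr}}$, $d_i(j,j')=\deg_{\mathbb{C}[z]}(q^{(i)}_j(z)-q^{(i)}_{j'}(z))-2$ for $j\ne j'$. Vertices: $\mathsf{Q}_0=\mathsf{Q}_0^{\mathrm{irr}}\sqcup\mathsf{Q}_0^{\mathrm{leg}}$, $\mathsf{Q}_0^{\mathrm{irr}}=\{[i,j]\mid i\in I_{\mathrm{irr}},1\le j\le m^{(i)}\}$, $\mathsf{Q}_0^{\mathrm{leg}}=\{[i,j,k]\mid0\le i\le p,1\le j\le m^{(i)},1\le k\le e_{[i,j]}-1\}$. Arrows: one $[0,j]\to[i,j']$ for all $j,j'$ and $i\in I_{\mathrm{irr}}\setminus\{0\}$; $d_i(j,j')$ arrows $[i,j]\to[i,j']$ for $i\in I_{\mathrm{irr}}$, $j<j'$; one $[i,j,k]\to[i,j,k-1]$ for $k\ge2$; one $[i,j,1]\to[i,j]$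 for $i\in I_{\mathrm{irr}}$; one $[i,1,1]\to[0,j]$ for $i\in I_{\mathrm{reg}}$ and all $j$. Set $\alpha_{[i,j]}=n^{(i)}_j$, $\alpha_{[i,j,k]}=\mathrm{rank}\prod_{l=1}^k(R^{(i)}_j-\xi^{[i,j]}_l)$; $\lambda_{[i,j]}=-\xi^{[i,j]}_1$ for $i\in I_{\mathrm{irr}}\setminus\{0\}$, $\lambda_{[0,j]}=-\xi^{[0,j]}_1-\sum_{i\in I_{\mathrm{reg}}}\xi^{[i,1]}_1$, $\lambda_{[i,j,k]}=\xi^{[i,j]}_k-\xi^{[i,j]}_{k+1}$. **Form, roots, fundamental set.** $\langle\alpha,\beta\rangle=\sum_a\alpha_a\beta_a-\sum_\rho\alpha_{s(\rho)}\beta_{t(\rho)}$, $(\alpha,\beta)=\langle\alpha,\beta\rangle+\langle\beta,\alpha\rangle$, $q(\alpha)=\frac12(\alpha,\alpha)$, $p(\alpha)=1-q(\alpha)$. Positive roots are those of Kac's root system of $\mathsf{Q}$; $\epsilon_a$ is the standard basis of $\mathbb{Z}^{\mathsf{Q}_0}$. $\mathcal{L}=\{\beta\in\mathbb{Z}^{\mathsf{Q}_0}\mid\sum_j\beta_{[0,j]}=\sum_j\beta_{[i,j]}\ \forall i\in I_{\mathrm{irr}}\setminus\{0\}\}$, $\mathcal{L}^+=\mathcal{L}\cap(\mathbb{Z}_{\ge0})^{\mathsf{Q}_0}$. $\Sigma_\lambda^{\mathrm{dif}}$ is the set of $\beta\in\mathcal{L}^+$ that are positive roots with $\beta\cdot\lambda=0$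 and such that $p(\beta)>p(\beta_1)+\cdots+p(\beta_r)$ for every decomposition (with $r\ge2$) $\beta=\beta_1+\cdots+\beta_r$ into positive roots $\beta_i\in\mathcal{L}^+$ with $\beta_i\cdot\lambda=0$. $\mathcal{J}=\prod_{i=0}^p\{[i,j]\mid1\le j\le m^{(i)}\}$; for $\mathbf{i}=([i,j_i])_i\in\mathcal{J}$, $\epsilon_{\mathbf{i}}=\sum_{i\in I_{\mathrm{irr}}}\epsilon_{[i,j_i]}$. $\tilde F$ is the set of $\beta\in\mathcal{L}^+\setminus\{0\}$ with connected support and $(\beta,\epsilon_a)\le0$ for all $a\in\mathcal{J}\cup\mathsf{Q}_0^{\mathrm{leg}}$. $\alpha$ is reduced if there is no $i\in\{1,\ldots,p\}$ for which exactly one $j$ has $n^{(i)}_j\ne0$ and, for this $j$, $e_{[i,j]}=1$ (i.e. no $B^{(i)}$ with $i\ge1$ is scalar). **Families.** Let $\mathbb{T}$ be a contractible complex manifold, $a_i\colon\mathbb{T}\to\mathbb{P}^1\times\mathbb{T}$, $0\le i\le p$, holomorphic sections pairwise distinct in each fibre $\mathbb{P}^1_t=\mathbb{P}^1\times\{t\}$, $a_0\equiv\infty$, $z_0=1/z$, $z_i=z-a_i(t)$. A smooth family $\mathbf{B}(t)$ of collections of HTL normal forms ($B^{(i)}(t)$ in the variable $z_i$, with fixed block sizes) is admissible if all $d_i(j,j')$ and $R^{(i)}_j$ are independent of $t$; non-resonant if moreover eigenvalues of each $R^{(i)}_j$ never differ by a nonzero integer. The data $(\mathsf{Q},\lambda,\alpha)$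 is then independent of $t$. An admissible family with $(\mathbf{B}(t))$ is a family $(\mathcal{O}^n_{\mathbb{P}^1_t},\nabla_t)\in\mathfrak{M}(\mathbf{B}(t))$, with $(\mathbf{B}(t))$ non-resonant admissible, such that, writing $\nabla_t=d-A_i(t,z_i)dz_i$ near $z_i=0$, there are holomorphic maps $\widehat g_i\colon\mathbb{T}\to\mathrm{GL}(n,\mathbb{C}[[z_i]])$ with $A_i(t,z_i)=\widehat g_i(t)[B^{(i)}(t)]$. Its spectral data is $(\mathsf{Q},\lambda,\alpha)$ and its dimension is $2p(\alpha)$. It is integrable if there is a flat meromorphic connection $\widehat\nabla$ on $\mathcal{O}^n_{\mathbb{P}^1\times\mathbb{T}}$ with poles on $\bigcup_ia_i(\mathbb{T})$ restricting to $\nabla_t$ on each $\mathbb{P}^1_t$. An admissible integrable family is fundamental if $\alpha\in\tilde F\cap\Sigma_\lambda^{\mathrm{dif}}$ and $\alpha$ is reduced. **Spectral type.** The spectral type of such a family is the pair $\left(\left((m_{[i,j,1]},\ldots,m_{[i,j,e_{[i,j]}]})\right)_{0\le i\le p,1\le j\le m^{(i)}},\ (d_i(j,j'))_{0\le i\le p,\,1\le j<j'\le m^{(i)}}\right)$, with $m_{[i,j,k]}=\alpha_{[i,j,k-1]}-\alpha_{[i,j,k]}$, where $\alpha_{[i,j,0]}=n^{(i)}_j$ and $\alpha_{[i,j,e_{[i,j]}]}=0$. Sequences are regarded as elements of $\varinjlim\mathbb{Z}^n$ (trailing zeros ignored), and spectral types are identified under permutations of the index $i$, of the indices $j$ for each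 $i$, and of the indices $k$ for each $[i,j]$. *)

(* Defs.v *)
From HB Require Import structures.
From mathcomp Require Import all_boot all_order all_algebra.
From mathcomp Require Import all_classical all_reals all_analysis.
From mathcomp Require Import complex.

Set Implicit Arguments.
Unset Strict Implicit.
Unset Printing Implicit Defensive.

Import Order.TTheory GRing.Theory Num.Theory.
Import numFieldNormedType.Exports.

Local Open Scope classical_set_scope.
Local Open Scope ring_scope.

(* Naming the carrier as a numClosedFieldType lets the generic topology and
   normed-module instances of MathComp-Analysis apply to it. *)
Definition cplx (R : realType) : numClosedFieldType := R[i].

Section ComplexManifold.
Context {R : realType}.
Local Notation C := (cplx R).

(* C-Frechet-differentiability at every point of U; U is open in every use. *)
Definition holomorphic_on (V W : normedModType C) (U : set V) (f : V -> W) :=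
  forall x, U x -> differentiable f x.

Definition real_quotient (V W : normedModType C) (v : V) (f : V -> W) (x : V)
    (h : R) : W :=
  let hC : C := (h%:C)%C in hC^-1 *: (f (hC *: v + x) - f x).

Definition real_derivable (V W : normedModType C) (v : V) (f : V -> W) (x : V) :=
  cvg (real_quotient v f x h @[h --> (0 : R)^']).

Definition real_derive (V W : normedModType C) (v : V) (f : V -> W) (x : V) : W :=
  lim (real_quotient v f x h @[h --> (0 : R)^']).

(* C^oo in the real sense: on U all iterated real directional derivatives
   exist and are continuous. *)
Definition smooth_on (V W : normedModType C) (U : set V) (f : V -> W) :=
  forall (vs : seq V) (x : V), U x ->
    {for x, continuous (foldr (@real_derive V W) f vs)} /\
    (forall v, real_derivable v (foldr (@real_derive V W) f vs) x).

Record complex_atlas (T : topologicalType) (N : nat) := ComplexAtlas {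
  chart_index : Type;
  chart_dom : chart_index -> set T;
  chart_map : chart_index -> T -> 'rV[C]_N;
  chart_inv : chart_index -> 'rV[C]_N -> T;
  chart_img := fun c => chart_map c @` chart_dom c;
  chart_cover : forall t, exists c, chart_dom c t;
  chart_dom_open : forall c, open (chart_dom c);
  chart_img_open : forall c, open (chart_img c);
  chart_mapK : forall c t, chart_dom c t -> chart_inv c (chart_map c t) = t;
  chart_map_cont : forall c, {within chart_dom c, continuous (chart_map c)};
  chart_inv_cont : forall c, {within chart_img c, continuous (chart_inv c)};
  chart_transition : forall c c',
    holomorphic_on (chart_map c @` (chart_dom c `&` chart_dom c'))
                   (chart_map c' \o chart_inv c) }.

Definition holomorphic_map (T : topologicalType) (N : nat)
    (M : complex_atlas T N) (W : normedModType C) (f : T -> W) :=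
  forall c : chart_index M,
    holomorphic_on (chart_img c) (f \o chart_inv c).

Definition smooth_map (T : topologicalType) (N : nat)
    (M : complex_atlas T N) (W : normedModType C) (f : T -> W) :=
  forall c : chart_index M, smooth_on (chart_img c) (f \o chart_inv c).

Definition contractible (T : topologicalType) :=
  exists (t0 : T) (H : T * R -> T),
    [/\ {within [set: T] `*` [set s : R | 0 <= s <= 1], continuous H},
        forall t, H (t, 0) = t & forall t, H (t, 1) = t0].

End ComplexManifold.

(* An element of M(n, C((z))) is encoded by its coefficients f : int -> 'M_n
   (f m is the coefficient of z^m), vanishing for m << 0. *)
Section Laurent.
Context {R : realType} {n : nat}.
Local Notation C := (cplx R).

Definition laurent := int -> 'M[C]_n.

Definition is_power_series (f : laurent) := forall m : int, m < 0 -> f m = 0.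

(* Finitely supported sum as soon as f and g vanish in degrees << 0. *)
Definition lmul (f g : laurent) : laurent :=
  fun m => \sum_(l \in [set: int]) f l *m g (m - l).

Definition lone : laurent := fun m => if m == 0 then 1%:M else 0.

Definition lderiv (f : laurent) : laurent :=
  fun m => ((m + 1)%:~R : C) *: f (m + 1).

(* X belongs to GL(n, C[[z]]) and has inverse Y *)
Definition GL_power_series (X Y : laurent) :=
  [/\ is_power_series X, is_power_series Y, lmul X Y = lone & lmul Y X = lone].

(* X[A] = X A X^-1 + X' X^-1, with Y = X^-1 *)
Definition gauge (X Y A : laurent) : laurent :=
  fun m => lmul (lmul X A) Y m + lmul (lderiv X) Y m.

(* L is the Laurent expansion at 0 of a function f meromorphic at 0 *)
Definition laurent_expansion (f : C -> 'M[C]_n) (L : laurent) :=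
  exists N : nat, (forall m : int, m < - N%:Z -> L m = 0) /\
    \forall w \near (0 : C)^',
      (fun M : nat => \sum_(l < M) (w ^ (l%:Z - N%:Z)) *: L (l%:Z - N%:Z))
        @ \oo --> f w.

End Laurent.
Arguments laurent : clear implicits.

Record blocks (n : nat) := Blocks {
  nb : nat;
  bsize : 'I_nb -> nat;
  bsize_gt0 : forall j, (0 < bsize j)%N;
  bsize_sum : (\sum_j bsize j)%N = n }.

Section HTL.
Context {R : realType} {n : nat}.
Local Notation C := (cplx R).

(* diag(q_j(z^-1) I + R_j z^-1); hq j is q_j as a polynomial in z^-1. *)
Record htl (b : blocks n) := HTL {
  hq : 'I_(nb b) -> {poly C};
  hres : forall j : 'I_(nb b), 'M[C]_(bsize j);
  hq_polar : forall j l, (l < 2)%N -> (hq j)`_l = 0;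
  hq_inj : injective hq }.

Context {b : blocks n}.

(* Recall that Negz k = - k.+1. *)
Definition htl_laurent (B : htl b) : laurent R n := fun m =>
  castmx (bsize_sum b, bsize_sum b)
    (\mxdiag_(j < nb b)
       (if m is Negz k then
          ((hq B j)`_(k.+1))%:M + (if k == 0%N then hres B j else 0)
        else 0 : 'M[C]_(bsize j))).

Definition htl_pole_order (B : htl b) : nat :=
  \max_(j < nb b) maxn (size (hq B j)).-1 (hres B j != 0%R).

(* d(j, j') = deg (q_j - q_j') - 2; for j <> j' the difference has degree at
   least 2, so the truncated subtraction is exact. *)
Definition htl_d (B : htl b) (j j' : 'I_(nb b)) : nat :=
  ((size (hq B j - hq B j')%R).-1 - 2)%N.

(* the class of L mod M(n, C[[z]]) is in the truncated orbit of B *)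
Definition in_truncated_orbit (B : htl b) (L : laurent R n) :=
  exists X Y, GL_power_series X Y /\
    is_power_series (fun m => lmul (lmul X (htl_laurent B)) Y m - L m).

Definition non_resonant (B : htl b) :=
  forall j (x y : C), eigenvalue (hres B j) x -> eigenvalue (hres B j) y ->
    forall k : int, x - y = k%:~R -> k = 0.

End HTL.

(* A connection on the trivial bundle over P^1 is d - A(z) dz.  Its
   singular points are a_0 = oo (index ord0 : 'I_p.+1) and the finite points
   a_1, .., a_p, given as a : 'I_p -> C, where a i' is attached to the index
   lift ord0 i' : 'I_p.+1. *)
Section Connection.
Context {R : realType} {n p : nat}.
Local Notation C := (cplx R).

(* A_i such that A(z) dz = A_i(z_i) dz_i, with z_0 = 1/z, z_i = z - a_i *)
Definition local_form (a : 'I_p -> C) (A : C -> 'M[C]_n) (i : 'I_p.+1) :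
    C -> 'M[C]_n :=
  if unlift ord0 i is Some i' then fun w => A (w + a i')
  else fun w => (- (w ^- 2)) *: A (w^-1).

Definition regular_points (a : 'I_p -> C) : set C :=
  [set z | forall i, z != a i].

Definition stable (a : 'I_p -> C) (A : C -> 'M[C]_n) :=
  forall W : {vspace 'cV[C]_n},
    (forall z, regular_points a z -> forall w, w \in W -> A z *m w \in W) ->
    W = 0%VS \/ W = fullv.

Definition in_moduli (a : 'I_p -> C) (bl : 'I_p.+1 -> blocks n)
    (B : forall i, htl (bl i)) (A : C -> 'M[C]_n) :=
  [/\ holomorphic_on (regular_points a) A,
      forall i, exists L : laurent R n,
        [/\ laurent_expansion (local_form a A i) L,
            forall m : int, m < - (htl_pole_order (B i))%:Z -> L m = 0 &
            in_truncated_orbit (B i) L]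
    & stable a A].

End Connection.

Section Families.
Context {R : realType}.
Local Notation C := (cplx R).

(* A holomorphic section a_i of P^1 x T -> T which avoids the section a_0 = oo
   in every fibre is the same as a holomorphic function a_i : T -> C. *)
Record conn_family := Family {
  fn : nat;
  fp : nat;
  fbl : 'I_fp.+1 -> blocks fn;
  fT : topologicalType;
  fdim : nat;
  fM : @complex_atlas R fT fdim;
  fa : 'I_fp -> fT -> C;
  fB : fT -> forall i, @htl R fn (fbl i);
  fA : fT -> C -> 'M[C]_fn }.

Variable F : conn_family.
Local Notation T := (fT F).

Definition contractible_base :=
  [/\ hausdorff_space T, @second_countable T & @contractible R T].

Definition distinct_points :=
  (forall i, holomorphic_map (fM F) (fa i : T -> C)) /\
  (forall t : T, injective (fun i : 'I_(fp F) => fa i t)).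

Definition smooth_normal_forms :=
  (forall i j l, smooth_map (fM F) (fun t : T => (hq (fB t i) j)`_l : C)) /\
  (forall i j, smooth_map (fM F) (fun t : T => hres (fB t i) j)).

Definition admissible_normal_forms :=
  (forall (t t' : T) i (j j' : 'I_(nb (fbl i))), j != j' ->
     htl_d (fB t i) j j' = htl_d (fB t' i) j j') /\
  (forall (t t' : T) i (j : 'I_(nb (fbl i))),
     hres (fB t i) j = hres (fB t' i) j).

(* A_i(t, z_i) = g_i(t)[B^(i)(t)] with g_i : T -> GL(n, C[[z_i]]) holomorphic,
   i.e. with holomorphic coefficients *)
Definition formal_reduction :=
  exists g ginv : T -> forall i : 'I_(fp F).+1, laurent R (fn F),
    forall i,
    [/\ forall m, holomorphic_map (fM F) (fun t => g t i m),
        forall t, GL_power_series (g t i) (ginv t i) &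
        forall t, laurent_expansion (local_form (fun i => fa i t) (fA t) i)
          (gauge (g t i) (ginv t i) (htl_laurent (fB t i)))].

Definition admissible_family :=
  [/\ (0 < fn F)%N, contractible_base, distinct_points,
      [/\ smooth_normal_forms, admissible_normal_forms &
          forall (t : T) i, non_resonant (fB t i)] &
      (forall t : T, in_moduli (fun i => fa i t) (fB t) (fA t)) /\
      formal_reduction].

End Families.
Arguments conn_family : clear implicits.

Section Integrable.
Context {R : realType} (F : conn_family R).
Local Notation C := (cplx R).
Local Notation T := (fT F).
Local Notation n := (fn F).
Local Notation chart := (chart_index (fM F)).
Local Notation V := (C * 'rV[C]_(fdim F))%type.

(* (P^1 x chart) minus the graphs of the a_i, in coordinates (z, x) *)
Definition chart_regular (c : chart) : set V :=
  [set zx | chart_img c zx.2 /\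
            regular_points (fun i => fa i (chart_inv c zx.2)) zx.1].

(* meromorphic on P^1 x chart, with poles only on the graphs of the a_i *)
Definition meromorphic_in_chart (c : chart) (f : V -> 'M[C]_n) :=
  [/\ holomorphic_on (chart_regular c) f,
      forall (i : 'I_(fp F)) x0, chart_img c x0 ->
        exists (r : nat) (G : V -> 'M[C]_n),
          \forall zx \near ((fa i (chart_inv c x0), x0) : V),
            differentiable G zx /\
            (chart_regular c zx ->
               G zx = ((zx.1 - fa i (chart_inv c zx.2)) ^+ r) *: f zx) &
      forall x0, chart_img c x0 ->
        exists (r : nat) (G : V -> 'M[C]_n),
          \forall wx \near ((0, x0) : V),
            differentiable G wx /\
            (wx.1 != 0 -> G wx = (wx.1 ^+ r) *: f (wx.1^-1, wx.2))].

(* coordinate directions: None is d/dz, Some k is d/dx_k *)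
Definition coord_dir (o : option 'I_(fdim F)) : V :=
  if o is Some k then (0, delta_mx 0 k) else (1, 0).

(* In the chart c the extended connection is
     d - Om c None dz - \sum_k Om c (Some k) dx_k;
   the last two clauses say that these expressions glue to a 1-form on
   P^1 x T, and that d Om = Om /\ Om. *)
Definition integrable_family :=
  exists Om : chart -> option 'I_(fdim F) -> V -> 'M[C]_n,
  [/\ forall c o, meromorphic_in_chart c (Om c o),
      forall c zx, chart_regular c zx ->
        Om c None zx = fA (chart_inv c zx.2) zx.1,
      forall (c c' : chart) (t : T) (z : C) k,
        chart_dom c t -> chart_dom c' t -> regular_points (fun i => fa i t) z ->
        Om c (Some k) (z, chart_map c t) =
          \sum_l ('D_(delta_mx 0 k) (chart_map c' \o chart_inv c)
                    (chart_map c t)) 0 l *: Om c' (Some l) (z, chart_map c' t) &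
      forall c o o' zx, chart_regular c zx ->
        'D_(coord_dir o) (Om c o') zx - 'D_(coord_dir o') (Om c o) zx =
          Om c o zx *m Om c o' zx - Om c o' zx *m Om c o zx].

End Integrable.

Record quiver := Quiver {
  qvert : finType;
  qarr : qvert -> qvert -> nat (* number of arrows from the first to the second *)
}.

Section Quiver.
Variable Q : quiver.
Local Notation dimv := {ffun qvert Q -> int}.

(* Grouping the arrows by source and target. *)
Definition euler (x y : dimv) : int :=
  \sum_v x v * y v - \sum_v \sum_w (qarr v w)%:Z * (x v * y w).

Definition bil (x y : dimv) : int := euler x y + euler y x.

(* q(x) = (x, x) / 2, see bilxx *)
Definition qform (x : dimv) : int := euler x x.

Lemma bilxx x : bil x x = qform x *+ 2.
Proof. by rewrite /bil /qform mulr2n. Qed.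

Definition pfun (x : dimv) : int := 1 - qform x.

Definition eps (v : qvert Q) : dimv := [ffun w => (w == v)%:R].

Definition nonneg (x : dimv) := forall v, 0 <= x v.

Definition connected_support (x : dimv) :=
  forall v w, x v != 0 -> x w != 0 ->
    connect (fun u u' => [&& x u != 0, x u' != 0 &
                             (0 < qarr u u' + qarr u' u)%N]) v w.

(* Kac's root system: the real roots are the Weyl translates of the simple
   roots at loop-free vertices, the imaginary roots the translates, up to
   sign, of the fundamental region. *)
Definition loopfree (v : qvert Q) := qarr v v = 0%N.

Definition reflection (v : qvert Q) (x : dimv) : dimv :=
  x - eps v *~ bil x (eps v).

Inductive weyl_orbit (x : dimv) : dimv -> Prop :=
| weyl_refl : weyl_orbit x x
| weyl_step y v : weyl_orbit x y -> loopfree v ->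
    weyl_orbit x (reflection v y).

Definition fundamental_region (x : dimv) :=
  [/\ x != 0, nonneg x, connected_support x & forall v, bil x (eps v) <= 0].

Definition kac_root (x : dimv) :=
  (exists2 v, loopfree v & weyl_orbit (eps v) x) \/
  (exists2 y, fundamental_region y & weyl_orbit y x \/ weyl_orbit y (- x)).

Definition positive_root (x : dimv) := kac_root x /\ nonneg x.

End Quiver.

(* The quiver data attached to a collection of HTL normal forms and a choice
   of xi^[i,j].  Leg indices are shifted: the vertex [i,j,k+1] is encoded by
   k : 'I_(e_[i,j] - 1), and xi^[i,j]_(k+1) is the item k of xi i j. *)
Section QuiverData.
Context {R : realType} {n p : nat} {bl : 'I_p.+1 -> blocks n}.
Local Notation C := (cplx R).
Variables (B : forall i, @htl R n (bl i)).
Variable xi : forall i, 'I_(nb (bl i)) -> seq C.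

Definition xi_prod i (j : 'I_(nb (bl i))) (s : seq C) : 'M[C]_(bsize j) :=
  \prod_(x <- s) (hres (B i) j - x%:M).

Definition xi_admissible :=
  forall i (j : 'I_(nb (bl i))), xi_prod j (xi j) = 0 /\
    forall s : seq C, xi_prod j s = 0 -> (size (xi j) <= size s)%N.

Definition e_ i (j : 'I_(nb (bl i))) : nat := size (xi j).

Definition irr (i : 'I_p.+1) : bool := (1 < nb (bl i))%N || (i == ord0).

Definition blk_index := {i : 'I_p.+1 & 'I_(nb (bl i))}.
Definition irr_vertex := {u : blk_index | irr (tag u)}.
Definition leg_vertex := {u : blk_index & 'I_(e_ (tagged u)).-1}.
Definition vertex := (irr_vertex + leg_vertex)%type.

Definition arrows (v w : vertex) : nat :=
  match v, w with
  | inl v, inl w =>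
      let v := val v in let w := val w in
      if tag v == tag w then
        if (tagged v < tagged w)%N
        then htl_d (B (tag v)) (tagged v) (tagged_as v w) else 0%N
      else (tag v == ord0)
  | inr v, inr w => (tag v == tag w) && (tagged v == (tagged w).+1 :> nat)
  | inr v, inl w =>
      (tagged v == 0%N :> nat) &&
      (if irr (tag (tag v)) then tag v == val w else tag (val w) == ord0)
  | inl _, inr _ => 0%N
  end.

Definition dquiver : quiver := @Quiver vertex arrows.

Local Notation dimv := {ffun vertex -> int}.

(* alpha_[i,j,k], extended by alpha_[i,j,0] = n_j and by 0 for k >= e_[i,j] *)
Definition alpha_leg i (j : 'I_(nb (bl i))) (k : nat) : nat :=
  \rank (xi_prod j (take k (xi j))).

Definition alpha : dimv := [ffun v : vertex =>
  match v with
  | inl u => (bsize (tagged (val u)))%:Z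
  | inr u => (alpha_leg (tagged (tag u)) (tagged u).+1)%:Z
  end].

(* For i regular there is exactly one j. *)
Definition lambda (v : vertex) : C :=
  match v with
  | inl u => - (xi (tagged (val u)))`_0
      - (if tag (val u) == ord0 then
           \sum_(i | ~~ irr i) \sum_(j < nb (bl i)) (xi j)`_0 else 0)
  | inr u => let x := xi (tagged (tag u)) in
      x`_(tagged u) - x`_((tagged u).+1)
  end.

Definition dot_lambda (x : dimv) : C := \sum_v (x v)%:~R * lambda v.

Definition irr_sum (x : dimv) (i : 'I_p.+1) : int :=
  \sum_(u : irr_vertex | tag (val u) == i) x (inl u).

Definition in_L (x : dimv) :=
  forall i, irr i -> i != ord0 -> irr_sum x ord0 = irr_sum x i.

Definition in_Lplus (x : dimv) := in_L x /\ nonneg (Q := dquiver) x.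

Definition candidate (x : dimv) :=
  [/\ in_Lplus x, positive_root (Q := dquiver) x & dot_lambda x = 0].

Definition Sigma_dif (x : dimv) :=
  candidate x /\
  forall s : seq dimv, (1 < size s)%N -> (forall y, y \in s -> candidate y) ->
    x = \sum_(y <- s) y -> \sum_(y <- s) pfun (Q := dquiver) y < pfun (Q := dquiver) x.

(* epsilon_a for a = ([i, ji i])_i in J *)
Definition eps_J (ji : forall i, 'I_(nb (bl i))) : dimv := [ffun v : vertex =>
  match v return int with
  | inl u => (tagged (val u) == ji (tag (val u)))%:R
  | inr _ => 0
  end].

Definition F_tilde (x : dimv) :=
  [/\ in_Lplus x, x != 0, connected_support (Q := dquiver) x,
      forall ji, bil (Q := dquiver) x (eps_J ji) <= 0 &
      forall u : leg_vertex, bil (Q := dquiver) x (eps (Q := dquiver) (inr u)) <= 0].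

Definition reduced :=
  ~ exists i : 'I_p.+1, i != ord0 /\
      exists j : 'I_(nb (bl i)),
        [/\ bsize j != 0%N, (forall j', j' != j -> bsize j' = 0%N)
          & e_ j = 1%N].

Definition fundamental :=
  [/\ F_tilde alpha, Sigma_dif alpha & reduced].

Definition dimension : int := pfun (Q := dquiver) alpha *+ 2.

End QuiverData.

(* Points are indexed by i < st_p.+1 and blocks by j < st_nb i; st_mult i j is
   the sequence (m_[i,j,k+1])_k in lim Z^n, extended by zero; st_deg i j j' is
   d_i(j, j'), stored symmetrically so that permutations of the j act. *)
Record spectral_type := SpectralType {
  st_p : nat;
  st_nb : 'I_st_p.+1 -> nat;
  st_mult : forall i, 'I_(st_nb i) -> nat -> int;
  st_deg : forall i, 'I_(st_nb i) -> 'I_(st_nb i) -> nat }.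

(* equality up to permutations of the i, of the j and of the k *)
Definition spectral_equiv (s s' : spectral_type) : Prop :=
  exists (f : 'I_(st_p s).+1 -> 'I_(st_p s').+1)
         (g : forall i, 'I_(st_nb i) -> 'I_(st_nb (f i)))
         (h : forall i, 'I_(st_nb i) -> nat -> nat),
  [/\ bijective f, forall i, bijective (@g i), forall i j, bijective (@h i j),
      forall i j k, st_mult (g i j) (h i j k) = st_mult j k &
      forall i j j', j != j' -> st_deg (g i j) (g i j') = st_deg j j'].

Section SpectralTypes.
Context {R : realType}.
Local Notation C := (cplx R).

Definition spectral_type_of (n p : nat) (bl : 'I_p.+1 -> blocks n)
    (B : forall i, @htl R n (bl i)) (xi : forall i, 'I_(nb (bl i)) -> seq C) :=
  @SpectralType p (fun i => nb (bl i))
    (fun i j k => (alpha_leg B xi j k)%:Z - (alpha_leg B xi j k.+1)%:Z)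
    (fun i j j' => htl_d (B i) j j').

End SpectralTypes.

(* Spectral types, as classes modulo spectral_equiv, of the fundamental
   admissible integrable families of dimension d.  The data at t do not depend
   on t for an admissible family. *)
Definition fundamental_spectral_types (R : realType) (d : nat) :
    set (set spectral_type) :=
  [set S | exists (F : conn_family R) (t : fT F)
             (xi : forall i, 'I_(nb (fbl i)) -> seq (cplx R)),
     [/\ admissible_family F, integrable_family F, xi_admissible (fB t) xi,
         fundamental (fB t) xi & dimension (fB t) xi = d%:Z /\
         S = [set s | spectral_equiv (spectral_type_of (fB t) xi) s]]].

(* Main.v *)
Require Import Defs.
From HB Require Import structures.
From mathcomp Require Import all_boot all_order all_algebra.
From mathcomp Require Import all_classical all_reals all_analysis.
From mathcomp Require Import zify ring.

Set Implicit Arguments.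
Unset Strict Implicit.
Unset Printing Implicit Defensive.

Import Order.TTheory GRing.Theory Num.Theory.

(** Write n for the rank, m_ijk for the multiplicities of the spectral type,
    s_ij = sum_k m_ijk for the block sizes, d_i(j,j') for the degrees and
    delta = d - 2.  On the lattice L the symmetric form of the quiver only
    sees these numbers [bil_dimvec].  Set
      D_ijk = 2 n - s_ij - m_ijk + sum_j' d_i(j,j') s_ij'.
    The conditions defining F-tilde say that the m_ijk do not increase with k
    and that the numbers D_i = min_jk D_ijk satisfy sum_i D_i >= 2 n.  The
    value (alpha, alpha) = - delta of the form then reads
      n (sum_i D_i - 2 n) + sum_ijk m_ijk (D_ijk - D_i) = delta,
    a sum of nonnegative terms.  So either n <= delta, or the datum is
    balanced: sum_i D_i = 2 n, and the m_ijk with D_ijk > D_i have sum at most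
    delta.

    The shape, namely the number of points, the numbers of blocks and the
    d_i(j,j'), is bounded in terms of delta [shape_bounded].  For a balanced
    datum of large rank, D_i >= n / 2 at each i except where the normal form
    is scalar, which being reduced only allows at i = 0; so there are few
    points.  Since d_i(j,j') + 2 is the degree of q_j - q_j', the relation
    d_i(j,j') = 0 is an equivalence on the blocks at i.  This keeps the block
    sizes at i comparable, so that there are few blocks.

    For a fixed shape the rank is bounded [rank_bounded].  Otherwise choose
    balanced data with ranks tending to infinity and pass to a subsequence
    along which every block size is either constant or increasing, and
    likewise every m_ij0 and every number of nonzero parts.  The form
    evaluated on two members of the sequence, which is symmetric, shows that a
    growing block has equal parts, whose number is eventually constant.  The
    difference of two members is then orthogonal to every growing block.  Such
    a null direction cannot vanish on a block [null_direction_rigid], again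
    because d_i(j,j') = 0 is transitive; hence every block grows, every D_ijk
    equals D_i, and delta = 0.  Applied to a combination of two members that
    vanishes on some block, the same rigidity shows that the two are
    proportional, so the larger one is divisible.

    For delta = 0 this contradicts the condition Sigma [Sigma_primitive]: if
    alpha = g beta with g > 1, then beta is a positive root orthogonal to
    lambda with p(beta) = 1 = p(alpha), and alpha is a sum of g copies of
    beta.

    Bounded shape and rank leave finitely many multiplicities. *)

Lemma big_ord_stable (T : Type) (idx : T) (op : Monoid.law idx) (M N : nat)
    (F : nat -> T) :
  (forall k, M <= k -> F k = idx) -> (forall k, N <= k -> F k = idx) ->
  \big[op/idx]_(k < M) F k = \big[op/idx]_(k < N) F k.
Proof.
wlog MN : M N / M <= N => [hwlog|] FM FN.
  by case/orP: (leq_total M N) => /hwlog ->.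
rewrite -!(big_mkord xpredT F) (big_cat_nat _ (n := M) (p := N)) //=.
rewrite -[LHS](Monoid.mulm1 op); congr (op _ _).
rewrite big_nat_cond big1 // => k.
by rewrite andbT => /andP[/FM ->].
Qed.

(** * Monotone subsequences *)

Lemma dependent_subsequence (P : nat -> nat -> Prop) :
  (forall t, exists2 t', t < t' & P t t') ->
  exists f : nat -> nat, forall t, f t < f t.+1 /\ P (f t) (f t.+1).
Proof.
move=> H; have [t|h hP] := @choice _ _ (fun t t' => t < t' /\ P t t').
  by have [t' ? ?] := H t; exists t'.
by exists (fun t => iter t h 0) => t; rewrite iterS; apply: hP.
Qed.

Lemma increasing_homo (f : nat -> nat) :
  (forall t, f t < f t.+1) -> {homo f : s t / s < t}.
Proof. by move=> H; apply: homo_ltn => // x y z; apply: ltn_trans. Qed.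

Lemma increasing_ge (f : nat -> nat) t : {homo f : s t / s < t} -> t <= f t.
Proof.
by move=> H; elim: t => // t IH; apply: leq_ltn_trans IH _; apply: H.
Qed.

Lemma ltn_sum_at (I : finType) (i0 : I) (F G : I -> nat) :
  (forall i, F i <= G i) -> F i0 < G i0 -> \sum_i F i < \sum_i G i.
Proof.
move=> le_FG lt0; rewrite (bigD1 i0) //= [X in _ < X](bigD1 i0) //=.
by rewrite -addSn leq_add //; apply: leq_sum.
Qed.

Definition tame (u : nat -> nat) :=
  (forall t, u t = u 0) \/ {homo u : s t / s < t}.

Lemma tame_comp u (f : nat -> nat) :
  {homo f : s t / s < t} -> tame u -> tame (u \o f).
Proof.
move=> f_incr [uc|ui]; first by left=> t /=; rewrite uc [RHS]uc.
by right=> s t /f_incr /ui.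
Qed.

(** Either some value is taken infinitely often, or the sequence tends to
    infinity. *)
Lemma tame_subsequence (u : nat -> nat) :
  exists2 f : nat -> nat, {homo f : s t / s < t} & tame (u \o f).
Proof.
have [[c Hc]|Hc] := pselect (exists c, forall t, exists2 t', t < t' & u t' = c).
  have [f fP] := dependent_subsequence (P := fun _ t' => u t' = c) Hc.
  exists (f \o succn) => [|].
    by apply: increasing_homo => t; case: (fP t.+1).
  by left=> t /=; have [_ ->] := fP t; have [_ ->] := fP 0.
have Hbig c : exists T, forall t, T < t -> c < u t.
  elim: c => [|c [T HT]].
    have /forallNP/(_ 0) := Hc => /existsNP[T HT].
    exists T => t Tt; rewrite lt0n; apply/eqP => ut.
    by apply: HT; exists t.
  have /forallNP/(_ c.+1) := Hc => /existsNP[T' HT'].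
  exists (maxn T T') => t; rewrite gtn_max => /andP[Tt T't].
  have := HT _ Tt; rewrite leq_eqVlt => /orP[/eqP ut|//].
  by case: HT'; exists t.
have [t|f fP] := dependent_subsequence (P := fun t t' => u t < u t').
  have [T HT] := Hbig (u t).
  exists (maxn t T).+1; first by rewrite ltnS leq_maxl.
  by apply: HT; rewrite ltnS leq_maxr.
exists f; first by apply: increasing_homo => t; case: (fP t).
by right; apply: increasing_homo => t; case: (fP t).
Qed.

Lemma tame_subsequence_fin (I : finType) (u : I -> nat -> nat) :
  exists2 f : nat -> nat, {homo f : s t / s < t} & forall i, tame (u i \o f).
Proof.
suff [f f_incr fP] : exists2 f : nat -> nat, {homo f : s t / s < t} &
    forall i, i \in enum I -> tame (u i \o f).
  by exists f => // i; apply: fP; rewrite mem_enum.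
elim: (enum I) => [|i r [f f_incr fP]]; first by exists id.
have [h h_incr hP] := tame_subsequence (u i \o f).
exists (f \o h) => [s t /h_incr /f_incr //|k].
rewrite inE => /predU1P[-> //|/fP kf].
by have := tame_comp h_incr kf.
Qed.

(** * Spectral data *)

Section SpectralData.
Variables (p : nat) (nb : 'I_p.+1 -> nat).
Variable deg : forall i, 'I_(nb i) -> 'I_(nb i) -> nat.
Variable delta : nat.
Arguments deg {i}.

(** The numerical content of a root of F-tilde with (alpha, alpha) = - delta,
    for a fixed shape [(p, nb, deg)].  In the notation of the introduction
    [codim x i] is D_i and [cap x j] is D_ijk - D_i + m_ijk, which does not
    depend on k; thus [cap x j - mu x j k] is the amount by which D_ijk
    exceeds its minimum, [balance] is the definition of [cap], and [defect] is
    the value of the form.  The clause [data_reduced] says that no normal form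
    at a finite point is scalar. *)
Record spectral_data := SpectralData {
  rk : nat;
  sz : forall i, 'I_(nb i) -> nat;
  mu : forall i, 'I_(nb i) -> nat -> nat;
  codim : 'I_p.+1 -> nat;
  cap : forall i, 'I_(nb i) -> nat;
  rk_gt0 : 0 < rk;
  sz_gt0 : forall i (j : 'I_(nb i)), 0 < sz j;
  sz_sum : forall i, \sum_(j < nb i) sz j = rk;
  mu_mono : forall i (j : 'I_(nb i)) k, mu j k.+1 <= mu j k;
  mu_big : forall i (j : 'I_(nb i)) k, rk <= k -> mu j k = 0;
  mu_sum : forall i (j : 'I_(nb i)), \sum_(k < rk) mu j k = sz j;
  balance : forall i (j : 'I_(nb i)),
    sz j + cap j + codim i = rk.*2 + \sum_(j' < nb i) deg j j' * sz j';
  cap_ge : forall i (j : 'I_(nb i)), mu j 0 <= cap j;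
  cap_attained : forall i, exists j : 'I_(nb i), cap j = mu j 0;
  codim_ge : rk.*2 <= \sum_i codim i;
  defect : rk * \sum_i codim i +
    \sum_i \sum_(j < nb i) \sum_(k < rk) mu j k * (cap j - mu j k) =
    rk * rk.*2 + delta;
  data_reduced : forall i (j : 'I_(nb i)), i != ord0 -> mu j 0 < rk;
  primitive : delta = 0 ->
    forall g, (forall i (j : 'I_(nb i)) k, g %| mu j k) -> g <= 1 }.

Hypothesis deg_diag : forall i (j : 'I_(nb i)), deg j j = 0.
Hypothesis deg_sym : forall i (j j' : 'I_(nb i)), deg j j' = deg j' j.
Hypothesis deg_trans0 : forall i (j j' j'' : 'I_(nb i)),
  deg j j' = 0 -> deg j' j'' = 0 -> deg j j'' = 0.

Implicit Types x y : spectral_data.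

Definition balanced x := \sum_i codim x i = (rk x).*2.

(** In the value of the form, the excess of sum_i D_i over 2 n is multiplied
    by n. *)
Lemma balanced_large x : delta < rk x -> balanced x.
Proof.
move=> lt_n; apply/eqP; rewrite eqn_leq codim_ge andbT leqNgt.
apply/negP => gt_ct; have := defect x; nia.
Qed.

Lemma mu_le x i (j : 'I_(nb i)) k l : k <= l -> mu x j l <= mu x j k.
Proof.
move/subnKC=> <-; elim: (l - k) => [|m IH]; first by rewrite addn0.
by rewrite addnS; apply: leq_trans (mu_mono x j _) IH.
Qed.

Lemma mu_le_cap x i (j : 'I_(nb i)) k : mu x j k <= cap x j.
Proof. exact: leq_trans (mu_le x j (leq0n k)) (cap_ge x j). Qed.

Lemma mu_sum_ge x i (j : 'I_(nb i)) M :
  rk x <= M -> \sum_(k < M) mu x j k = sz x j.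
Proof.
move=> le_M; rewrite -(mu_sum x j).
by apply: big_ord_stable => k k_ge; apply: (mu_big j); lia.
Qed.

Lemma mu_le_sz x i (j : 'I_(nb i)) k : mu x j k <= sz x j.
Proof.
have k_lt : k < maxn k.+1 (rk x) by rewrite leq_maxl.
rewrite -(mu_sum_ge j (leq_maxr k.+1 (rk x))).
by rewrite (bigD1 (Ordinal k_lt)) //= leq_addr.
Qed.

Lemma mu0_gt0 x i (j : 'I_(nb i)) : 0 < mu x j 0.
Proof.
rewrite lt0n; apply/eqP => mu0; have := sz_gt0 x j.
rewrite -(mu_sum x j) big1 // => k _; apply/eqP.
by rewrite -leqn0 -mu0; apply: mu_le.
Qed.

Lemma sz_le_rk x i (j : 'I_(nb i)) : sz x j <= rk x.
Proof. by rewrite -(sz_sum x i) (bigD1 j) //= leq_addr. Qed.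

Lemma defect_balanced x : balanced x ->
  \sum_i \sum_(j < nb i) \sum_(k < rk x) mu x j k * (cap x j - mu x j k) = delta.
Proof. by move=> bx; have := defect x; rewrite bx => /addnI. Qed.

Lemma block_defect_le x i (j : 'I_(nb i)) : balanced x ->
  \sum_(k < rk x) mu x j k * (cap x j - mu x j k) <= delta.
Proof.
move=> bx; rewrite -(defect_balanced bx) (bigD1 i) //= (bigD1 j) //=.
by rewrite -addnA leq_addr.
Qed.

Lemma part_defect_le x i (j : 'I_(nb i)) k : balanced x ->
  mu x j k * (cap x j - mu x j k) <= delta.
Proof.
move=> bx; have [k_lt|/(mu_big j) -> //] := ltnP k (rk x).
apply: leq_trans (block_defect_le j bx).
by rewrite (bigD1 (Ordinal k_lt)) //= leq_addr.
Qed.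

Lemma cap_le x i (j : 'I_(nb i)) k : balanced x -> mu x j k != 0 ->
  cap x j - mu x j k <= delta.
Proof. by move=> /(part_defect_le j k); nia. Qed.

(** If [cap] exceeded the largest part, then every part of the block would
    contribute at least its own size to the defect. *)
Lemma cap_large x i (j : 'I_(nb i)) : balanced x -> delta < sz x j ->
  cap x j = mu x j 0.
Proof.
move=> bx lt_s; apply/eqP; rewrite eqn_leq cap_ge andbT leqNgt.
apply/negP => lt_cap; have := block_defect_le j bx; apply/negP.
rewrite -ltnNge; apply: leq_trans lt_s _; rewrite -(mu_sum x j).
apply: leq_sum => k _; apply: leq_pmulr.
by rewrite subn_gt0; apply: leq_ltn_trans lt_cap; apply: mu_le.
Qed.

(** A nonzero part smaller than the largest part m contributes at least m - 1
    to the defect. *)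
Lemma mu_flat x i (j : 'I_(nb i)) k : balanced x -> delta.+1 < mu x j 0 ->
  mu x j k = 0 \/ mu x j k = mu x j 0.
Proof.
move=> bx lt_mu; have := part_defect_le j k bx.
by have := cap_ge x j; have := mu_le x j (leq0n k); nia.
Qed.

(** The balance equation gives d s_j' <= 2 s_j + delta, and the same holds
    with j and j' exchanged; use it for the larger of the two blocks. *)
Lemma deg_le x i (j j' : 'I_(nb i)) : balanced x -> deg j j' <= delta + 2.
Proof.
move=> bx.
have key (k l : 'I_(nb i)) : deg k l * sz x l <= (sz x k).*2 + delta.
  have codim_le : codim x i <= (rk x).*2 by rewrite -bx (bigD1 i) //= leq_addr.
  have := balance x k; rewrite (bigD1 l) //=.
  have mu0 := mu0_gt0 x k; have := cap_le bx (lt0n_neq0 mu0).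
  have := mu_le_sz x k 0; nia.
have := key j j'; have := key j' j; rewrite deg_sym.
have := sz_gt0 x j; have := sz_gt0 x j'; nia.
Qed.

(** * Comparison of two spectral data *)

(** This is the symmetry of the bilinear form, evaluated on two balanced data
    and stripped of the terms that are visibly symmetric. *)
Lemma cross_symmetry x y : balanced x -> balanced y ->
  \sum_i \sum_(j < nb i) sz y j * cap x j =
  \sum_i \sum_(j < nb i) sz x j * cap y j.
Proof.
have expand u v : balanced u ->
    \sum_i \sum_(j < nb i) sz v j * sz u j +
    \sum_i \sum_(j < nb i) sz v j * cap u j + (rk v * (rk u).*2) =
    \sum_(i < p.+1) rk v * (rk u).*2 +
    \sum_i \sum_(j < nb i) \sum_(j' < nb i) sz v j * (deg j j' * sz u j').
  move=> bu; rewrite -{1}bu big_distrr /= -!big_split /=.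
  apply: eq_bigr => i _; rewrite -!(sz_sum v i).
  rewrite !big_distrl /= -!big_split /=.
  apply: eq_bigr => j _; rewrite -big_distrr /= -mulnDr -mulnDr.
  by rewrite -mulnDr -(balance u j).
move=> bx by_; have := expand _ y bx; have := expand _ x by_.
have -> : \sum_i \sum_(j < nb i) \sum_(j' < nb i) sz y j * (deg j j' * sz x j') =
    \sum_i \sum_(j < nb i) \sum_(j' < nb i) sz x j * (deg j j' * sz y j').
  apply: eq_bigr => i _; rewrite exchange_big /=.
  by apply: eq_bigr => j _; apply: eq_bigr => j' _; rewrite deg_sym; lia.
have -> : \sum_i \sum_(j < nb i) sz y j * sz x j =
    \sum_i \sum_(j < nb i) sz x j * sz y j.
  by apply: eq_bigr => i _; apply: eq_bigr => j _; rewrite mulnC.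
have -> : \sum_(i < p.+1) rk y * (rk x).*2 = \sum_(i < p.+1) rk x * (rk y).*2.
  by apply: eq_bigr => i _; lia.
lia.
Qed.

Lemma block_exists x i : exists j : 'I_(nb i), true.
Proof. by have [j _] := cap_attained x i; exists j. Qed.

Definition support_le x y :=
  forall i (j : 'I_(nb i)) k, mu x j k != 0 -> mu y j k != 0.

(** When the support of [x] lies in that of [y], the parts of [y] over the
    support of [x] have excess at most delta.  The symmetry of the form turns
    this into a bound on the parts of [y] weighted by the excesses in [x],
    which does not involve [y]: a datum can only grow where [x] has no
    excess. *)
Lemma cross_defect_le x y i (j : 'I_(nb i)) : balanced x -> balanced y ->
  support_le x y -> rk x <= rk y ->
  \sum_(k < rk y) mu y j k * (cap x j - mu x j k) <= delta * (p.+1 * rk x).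
Proof.
move=> bx by_ sxy le_xy.
have expand u v : rk u <= rk y -> rk v <= rk y ->
    \sum_i \sum_(j < nb i) \sum_(k < rk y) mu v j k * (cap u j - mu u j k) +
    \sum_i \sum_(j < nb i) \sum_(k < rk y) mu v j k * mu u j k =
    \sum_i \sum_(j < nb i) sz v j * cap u j.
  move=> ule vle; rewrite -big_split; apply: eq_bigr => i' _ /=.
  rewrite -big_split; apply: eq_bigr => j' _ /=; rewrite -big_split /=.
  rewrite -(mu_sum_ge j' vle) big_distrl; apply: eq_bigr => k _ /=.
  by rewrite -mulnDr subnK // mu_le_cap.
have := expand x y le_xy (leqnn _); have := expand y x (leqnn _) le_xy.
rewrite (cross_symmetry bx by_).
have -> : \sum_i \sum_(j < nb i) \sum_(k < rk y) mu y j k * mu x j k =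
  \sum_i \sum_(j < nb i) \sum_(k < rk y) mu x j k * mu y j k.
  by do 3!(apply: eq_bigr => ? _); rewrite mulnC.
move=> <- /addIn E.
have le1 : \sum_i \sum_(j < nb i) \sum_(k < rk y) mu x j k * (cap y j - mu y j k)
    <= delta * (p.+1 * rk x).
  have -> : delta * (p.+1 * rk x) = \sum_(i < p.+1) rk x * delta.
    by rewrite sum_nat_const card_ord; lia.
  apply: leq_sum => i' _; rewrite -(sz_sum x i') big_distrl /=.
  apply: leq_sum => j' _; rewrite -(mu_sum_ge j' le_xy) big_distrl /=.
  apply: leq_sum => k _; have [->|nz] := eqVneq (mu x j' k) 0; first by [].
  by rewrite leq_mul2l cap_le ?orbT // sxy.
by apply: leq_trans le1; rewrite -E (bigD1 i) //= (bigD1 j) //= -addnA leq_addr.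
Qed.

Local Open Scope ring_scope.

(** A direction, given by its rank N, block sizes, largest parts and codims,
    is null when it pairs to zero with every block on which it is nonzero.
    Where it vanishes at a block j, the pairing is negative as soon as the
    direction is nonzero.  Indeed codim_i <= 2 N because the codims are
    nonnegative of sum 2 N; if the pairing at j were not negative, then
    codim_i = 2 N and d_i(j, -) would vanish on the support of the direction,
    so d_i would vanish between any two blocks of this support, and the
    equation at one of them would give codim_i < 2 N. *)
Lemma null_direction_rigid (N : int) (ctd : 'I_p.+1 -> int)
    (szd mud : forall i, 'I_(nb i) -> int) :
  0 < N ->
  (forall i (j : 'I_(nb i)), 0 <= mud i j <= szd i j) ->
  (forall i, \sum_(j < nb i) szd i j = N) ->
  \sum_i ctd i = N + N ->
  (forall i (j : 'I_(nb i)), szd i j != 0 ->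
     szd i j + mud i j + ctd i =
     N + N + \sum_(j' < nb i) (deg j j')%:Z * szd i j') ->
  forall i (j : 'I_(nb i)), szd i j = 0 ->
  ctd i < N + N + \sum_(j' < nb i) (deg j j')%:Z * szd i j'.
Proof.
move=> N_gt0 mus Ns cs bal i j sz0; rewrite ltNge; apply/negP => ctd_ge.
have sz_ge0 i' (j' : 'I_(nb i')) : 0 <= szd i' j' by have := mus i' j'; lia.
have term_ge0 i' (j1 j2 : 'I_(nb i')) : 0 <= (deg j1 j2)%:Z * szd i' j2.
  by rewrite mulr_ge0.
have ex i' : exists j', szd i' j' != 0.
  apply/existsP; rewrite -[[exists _, _]]negbK; apply/negP => /existsPn all0.
  have := Ns i'; rewrite big1 => [|j' _]; first by lia.
  by apply/eqP; have := all0 j'; rewrite negbK.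
have sz_leN i' (j' : 'I_(nb i')) : szd i' j' <= N.
  by rewrite -(Ns i') (bigD1 j') //= lerDl sumr_ge0.
have ctd_ge0 i' : 0 <= ctd i'.
  have [j' nz] := ex i'; have := bal _ _ nz.
  have : 0 <= \sum_(l < nb i') (deg j' l)%:Z * szd i' l by rewrite sumr_ge0.
  have := mus i' j'; have := sz_leN i' j'; lia.
have ctd_le : ctd i <= N + N by rewrite -cs (bigD1 i) //= lerDl sumr_ge0.
have deg0 j' : szd i j' != 0 -> deg j j' = 0%N.
  move=> nz; have /eqP : \sum_(j' < nb i) (deg j j')%:Z * szd i j' = 0.
    apply/eqP; rewrite eq_le sumr_ge0 ?andbT //; lia.
  rewrite psumr_eq0 // => /allP/(_ j' (mem_index_enum _)) /=.
  by rewrite mulf_eq0 (negPf nz) orbF eqz_nat => /eqP.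
have [j1 nz1] := ex i; have := bal _ _ nz1; rewrite big1 => [|j' _].
  have : 0 <= \sum_(j' < nb i) (deg j j')%:Z * szd i j' by rewrite sumr_ge0.
  by have := mus i j1; have := sz_ge0 i j1; lia.
have [->|nz] := eqVneq (szd i j') 0; first by rewrite mulr0.
by rewrite (@deg_trans0 _ j1 j j') ?mul0r ?deg0 // deg_sym deg0.
Qed.

Local Close Scope ring_scope.

(** * The rank is bounded for a fixed shape *)

Lemma mu_vanishes x i (j : 'I_(nb i)) : exists k, mu x j k == 0.
Proof. by exists (rk x); rewrite mu_big. Qed.

Definition len x i (j : 'I_(nb i)) := ex_minn (mu_vanishes x j).

Lemma mu_eq0 x i (j : 'I_(nb i)) k : (mu x j k == 0) = (len x j <= k).
Proof.
rewrite /len; case: ex_minnP => L /eqP L0 L_min.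
apply/idP/idP => [/L_min //|/(mu_le x j)].
by rewrite L0 leqn0.
Qed.

Lemma len_gt0 x i (j : 'I_(nb i)) : 0 < len x j.
Proof. by rewrite ltnNge -mu_eq0 -lt0n mu0_gt0. Qed.

Lemma sum_ltn (L M : nat) : \sum_(k < M) (k < L) = minn L M.
Proof.
elim: M => [|M IH]; first by rewrite big_ord0 minn0.
by rewrite big_ord_recr /= IH; lia.
Qed.

Lemma mu_flatE x i (j : 'I_(nb i)) k : balanced x -> delta.+1 < mu x j 0 ->
  mu x j k = (k < len x j) * mu x j 0.
Proof.
move=> bx lt_mu; have := mu_eq0 x j k.
by case: (mu_flat k bx lt_mu) => ->; have := mu0_gt0 x j; lia.
Qed.

Lemma sz_flatE x i (j : 'I_(nb i)) : balanced x -> delta.+1 < mu x j 0 ->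
  sz x j = len x j * mu x j 0.
Proof.
move=> bx lt_mu; rewrite -(mu_sum x j).
under eq_bigr => k _ do rewrite (mu_flatE _ bx lt_mu).
rewrite -big_distrl /= sum_ltn; congr (_ * _); apply/minn_idPl.
by rewrite -mu_eq0 mu_big.
Qed.

Lemma support_leP x y :
  (forall i (j : 'I_(nb i)), len x j <= len y j) -> support_le x y.
Proof.
move=> le_len i j k; rewrite !mu_eq0 -!ltnNge => lt_k.
exact: leq_trans lt_k (le_len i j).
Qed.

Section Sequence.
Variable g : nat -> spectral_data.
Hypothesis g_bal : forall t, balanced (g t).
Hypothesis g_rk : forall t, t < rk (g t).
Hypothesis rk_homo : forall s t, s <= t -> rk (g s) <= rk (g t).
Hypothesis sz_tame : forall i (j : 'I_(nb i)), tame (fun t => sz (g t) j).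
Hypothesis mu_tame : forall i (j : 'I_(nb i)), tame (fun t => mu (g t) j 0).
Hypothesis len_tame : forall i (j : 'I_(nb i)), tame (fun t => len (g t) j).

Lemma tame_le u s t : tame u -> s <= t -> u s <= u t.
Proof.
case=> [uc|ui]; first by rewrite (uc s) (uc t).
by rewrite leq_eqVlt => /predU1P[-> //|/ui /ltnW].
Qed.

Lemma seq_cross_le s t i (j : 'I_(nb i)) : s <= t ->
  \sum_(k < rk (g t)) mu (g t) j k * (cap (g s) j - mu (g s) j k)
    <= delta * (p.+1 * rk (g s)).
Proof.
move=> le_st; apply: cross_defect_le => //; last exact: rk_homo.
by apply: support_leP => i' j'; apply: tame_le (len_tame j') le_st.
Qed.

Definition growing i (j : 'I_(nb i)) := {homo (fun t => sz (g t) j) : s t / s < t}.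

(** If the largest part stayed constant, the block would grow by acquiring
    parts beyond the length that it has in the initial datum.  These have
    positive excess there, so [cross_defect_le] bounds their sum. *)
Lemma growing_mu i (j : 'I_(nb i)) : growing j ->
  {homo (fun t => mu (g t) j 0) : s t / s < t}.
Proof.
move=> gr; case: (mu_tame j) => [mu_c|//]; exfalso.
(* At index t the block is larger than the bound obtained below. *)
pose t := (len (g 0) j * mu (g 0) j 0 + delta * (p.+1 * rk (g 0))).+1.
have := increasing_ge t gr; rewrite /= -(mu_sum (g t) j).
have : \sum_(k < rk (g t)) mu (g t) j k <=
    \sum_(k < rk (g t)) (k < len (g 0) j) * mu (g 0) j 0 +
    \sum_(k < rk (g t)) mu (g t) j k * (cap (g 0) j - mu (g 0) j k).
  rewrite -big_split; apply: leq_sum => k _ /=.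
  have := mu_eq0 (g 0) j k; have := mu_le (g t) j (leq0n k).
  have := mu0_gt0 (g 0) j; have := cap_ge (g 0) j; rewrite (mu_c t).
  by case: ltnP => _; nia.
rewrite -big_distrl /= sum_ltn; have := seq_cross_le j (leq0n t).
have := leq_mul (geq_minl (len (g 0) j) (rk (g t))) (leqnn (mu (g 0) j 0)).
have tE : t = (len (g 0) j * mu (g 0) j 0 + delta * (p.+1 * rk (g 0))).+1 by [].
clearbody t; move: tE; set C := delta * _; set L := len _ _ * _.
set m1 := minn _ _ * _; set X := bigop _ _ _; set Y := bigop _ _ _; lia.
Qed.

Lemma growing_large i (j : 'I_(nb i)) t : growing j -> delta.+1 < t ->
  delta.+1 < mu (g t) j 0.
Proof.
by move=> gr lt_t; apply: leq_trans lt_t (increasing_ge t (growing_mu gr)).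
Qed.

(** If the length increased, a later datum would have a part, as large as its
    largest one, at a place where an earlier datum has none and hence a
    positive excess. *)
Lemma growing_len i (j : 'I_(nb i)) s t : growing j ->
  len (g s) j = len (g t) j.
Proof.
move=> gr; case: (len_tame j) => [lc|li]; first by rewrite lc (lc t).
exfalso.
pose a := delta.+2.
pose b := (a + delta * (p.+1 * rk (g a))).+1.
have le_ab : a <= b by rewrite /b; lia.
have k_nz : mu (g b) j (len (g a) j) != 0.
  by rewrite mu_eq0 -ltnNge; apply: li; rewrite /b; lia.
have := seq_cross_le j le_ab.
have [|le_rk] := ltnP (len (g a) j) (rk (g b)); last by rewrite mu_big ?eqxx in k_nz.
move=> k_lt; rewrite (bigD1 (Ordinal k_lt)) //=.
have /eqP -> : mu (g a) j (len (g a) j) == 0 by rewrite mu_eq0.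
have lb : delta.+1 < mu (g b) j 0 by apply: growing_large => //; rewrite /b /a; lia.
case: (mu_flat (len (g a) j) (g_bal b) lb) k_nz => -> // _.
have := increasing_ge b (growing_mu gr); have := mu0_gt0 (g a) j.
have := cap_ge (g a) j; rewrite subn0.
have bE : b = (a + delta * (p.+1 * rk (g a))).+1 by [].
clearbody b; move: bE; set C := delta * _; set X := bigop _ _ _; nia.
Qed.

Lemma growing_sz i (j : 'I_(nb i)) t : growing j -> delta.+1 < t ->
  sz (g t) j = len (g 0) j * mu (g t) j 0.
Proof.
move=> gr lt_t; rewrite (growing_len 0 t gr).
by apply: sz_flatE => //; apply: growing_large.
Qed.

Lemma growing_cap i (j : 'I_(nb i)) t : growing j -> delta.+1 < t ->
  cap (g t) j = mu (g t) j 0.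
Proof.
move=> gr lt_t; apply: cap_large => //.
apply: leq_trans (increasing_ge t gr); lia.
Qed.

Lemma growing_exists i : exists j : 'I_(nb i), growing j.
Proof.
have [//|no] := pselect (exists j : 'I_(nb i), growing j).
suff E : rk (g (rk (g 0))) = rk (g 0) by have := g_rk (rk (g 0)); rewrite E ltnn.
rewrite -[LHS](sz_sum _ i) -[RHS](sz_sum _ i); apply: eq_bigr => j _.
by case: (sz_tame j) => [-> //|gr]; case: no; exists j.
Qed.

Local Open Scope ring_scope.

(** The difference of two consecutive late data vanishes on the constant
    blocks and is null on the others.  By rigidity [cap] increases strictly on
    each constant block, whereas both sides of [cross_symmetry] agree on the
    growing blocks. *)
Lemma all_growing i (j : 'I_(nb i)) : growing j.
Proof.
case: (sz_tame j) => [szc|//]; exfalso.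
(* From index delta + 2 on, the largest part of a growing block exceeds
   delta + 1, so that its parts are equal. *)
pose a := delta.+2; pose b := delta.+3.
pose szd i (j : 'I_(nb i)) := (sz (g b) j)%:Z - (sz (g a) j)%:Z.
pose mud i (j : 'I_(nb i)) :=
  if szd i j == 0 then 0 else (mu (g b) j 0)%:Z - (mu (g a) j 0)%:Z.
pose N := (rk (g b))%:Z - (rk (g a))%:Z.
pose ctd i := (codim (g b) i)%:Z - (codim (g a) i)%:Z.
have rk_sum t i' : (rk (g t))%:Z = \sum_(j' < nb i') (sz (g t) j')%:Z.
  by rewrite -(sz_sum (g t) i') (big_morph Posz PoszD (erefl _)).
have sz_cst i' (j' : 'I_(nb i')) : szd i' j' = 0 -> sz (g b) j' = sz (g a) j'.
  by rewrite /szd; lia.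
have sz_gr i' (j' : 'I_(nb i')) : szd i' j' != 0 -> growing j'.
  by case: (sz_tame j') => [c|//]; rewrite /szd (c b) (c a) subrr.
have szd_gr i' (j' : 'I_(nb i')) : growing j' -> 0 < szd i' j'.
  by move=> /(_ a b (ltnSn _)) /=; rewrite /szd; lia.
have szd_ge0 i' (j' : 'I_(nb i')) : 0 <= szd i' j'.
  by have := tame_le (sz_tame j') (leqnSn a : (a <= b)%N); rewrite /szd /=; lia.
have capd i' (j' : 'I_(nb i')) : (cap (g b) j')%:Z - (cap (g a) j')%:Z
    + szd i' j' + ctd i' = N + N + \sum_(l < nb i') (deg j' l)%:Z * szd i' l.
  have -> : \sum_(l < nb i') (deg j' l)%:Z * szd i' l =
    (\sum_(l < nb i') deg j' l * sz (g b) l)%N%:Z -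
    (\sum_(l < nb i') deg j' l * sz (g a) l)%N%:Z.
    rewrite !(big_morph Posz PoszD (erefl _)) -sumrB.
    by apply: eq_bigr => l _; rewrite /szd mulrBr.
  have := balance (g a) j'; have := balance (g b) j'; rewrite /szd /ctd /N; lia.
have rigid i' (j' : 'I_(nb i')) : szd i' j' = 0 -> (cap (g a) j' < cap (g b) j')%N.
  move=> sz0; have := capd i' j'; rewrite sz0.
  suff : ctd i' < N + N + \sum_(l < nb i') (deg j' l)%:Z * szd i' l by lia.
  apply: (null_direction_rigid (mud := mud)) => //.
  - have [l l_gr] := growing_exists ord0.
    rewrite /N !(rk_sum _ ord0) -sumrB (bigD1 l) //=.
    apply: ltr_wpDr; first by rewrite sumr_ge0 // => l' _; apply: szd_ge0.
    exact: szd_gr.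
  - move=> i'' j''; rewrite /mud; case: eqP => [-> //|/eqP nz].
    have gr := sz_gr _ _ nz; rewrite /szd !(growing_sz gr) //.
    have := len_gt0 (g 0) j''; have := growing_mu gr (ltnSn a); rewrite /= -/b; nia.
  - by move=> i''; rewrite sumrB -!rk_sum.
  - rewrite /N sumrB -!(big_morph Posz PoszD (erefl _)) !g_bal; lia.
  - move=> i'' j'' nz; have gr := sz_gr _ _ nz.
    have := capd i'' j''; rewrite /mud (negPf nz) !(growing_cap gr) //; lia.
have := cross_symmetry (g_bal a) (g_bal b); apply/eqP.
rewrite ltn_eqF //.
have le_term i' (j' : 'I_(nb i')) :
    (sz (g b) j' * cap (g a) j' <= sz (g a) j' * cap (g b) j')%N.
  have [z|nz] := eqVneq (szd i' j') 0.
    by rewrite (sz_cst _ _ z) leq_mul2l (ltnW (rigid _ _ z)) orbT.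
  have gr := sz_gr _ _ nz; rewrite !(growing_sz gr) // !(growing_cap gr) //.
  by rewrite -!mulnA (mulnC (mu _ _ _)).
apply: (@ltn_sum_at _ i) => [i'|]; first by apply: leq_sum.
apply: (@ltn_sum_at _ j) => //.
have z : szd i j = 0 by rewrite /szd (szc b) (szc a) subrr.
by rewrite (sz_cst _ _ z) ltn_mul2l sz_gt0 rigid.
Qed.

Lemma seq_delta0 : delta = 0%N.
Proof.
rewrite -(defect_balanced (g_bal delta.+2)) big1 // => i _.
apply: big1 => j _; apply: big1 => k _.
have gr := @all_growing i j; rewrite growing_cap //.
have lb := growing_large gr (ltnSn delta.+1).
by case: (mu_flat k (g_bal _) lb) => ->; rewrite ?subnn ?muln0.
Qed.

(** Two late data have equal parts and equal lengths, so each of them solves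
    the same homogeneous linear system.  Let A and B be the parts of the data
    a and b on the block where their ratio B / A is least.  The combination
    A b - B a is nonnegative and vanishes on this block, so it is a null
    direction that rigidity forces to be zero.  Therefore B / gcd(A, B)
    divides b, although b is primitive. *)
Lemma seq_absurd : False.
Proof.
pose a := delta.+2; pose b := delta.+3.
pose blk := {i : 'I_p.+1 & 'I_(nb i)}.
pose ma (u : blk) := mu (g a) (tagged u) 0.
pose mb (u : blk) := mu (g b) (tagged u) 0.
have [[i0 j0] u0_min] : exists u0, forall u, (ma u * mb u0 <= ma u0 * mb u)%N.
  have [l _] := growing_exists ord0.
  pose r (u : blk) : rat := (mb u)%:Q / (ma u)%:Q.
  have [u0 _ u0_min] := @Order.TotalTheory.arg_minP _ _ blk (Tagged _ l) xpredT r isT.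
  exists u0 => u; have := u0_min u isT; rewrite /r.
  have ma_gt0 v : 0 < (ma v)%:Q :> rat by rewrite ltr0n mu0_gt0.
  rewrite ler_pdivrMr // mulrAC ler_pdivlMr // -!intrM ler_int.
  by lia.
pose A := mu (g a) j0 0; pose B := mu (g b) j0 0.
have A_gt0 : (0 < A)%N by apply: mu0_gt0.
have AB : (A < B)%N by apply: growing_mu (@all_growing _ j0) _ _ (ltnSn _).
pose muc i (j : 'I_(nb i)) := (A * mu (g b) j 0)%N%:Z - (B * mu (g a) j 0)%N%:Z.
pose szc i (j : 'I_(nb i)) := (A * sz (g b) j)%N%:Z - (B * sz (g a) j)%N%:Z.
pose N := (A * rk (g b))%N%:Z - (B * rk (g a))%N%:Z.
pose ctc i := (A * codim (g b) i)%N%:Z - (B * codim (g a) i)%N%:Z.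
have muc_ge0 i (j : 'I_(nb i)) : 0 <= muc i j.
  by have := u0_min (Tagged _ j); rewrite /muc /ma /mb /= -/A -/B; lia.
have szcE i (j : 'I_(nb i)) : szc i j = (len (g 0) j)%:Z * muc i j.
  by rewrite /szc /muc !(growing_sz (@all_growing _ j)) //; lia.
have rk_sum t i' : (rk (g t))%:Z = \sum_(j' < nb i') (sz (g t) j')%:Z.
  by rewrite -(sz_sum (g t) i') (big_morph Posz PoszD (erefl _)).
have szc_sum i : \sum_(j < nb i) szc i j = N.
  rewrite /N !PoszM !(rk_sum _ i) !mulr_sumr -sumrB.
  by apply: eq_bigr => j _; rewrite /szc !PoszM.
have szc_ge0 i (j : 'I_(nb i)) : 0 <= szc i j by rewrite szcE mulr_ge0.
have bal i (j : 'I_(nb i)) : szc i j + muc i j + ctc i =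
    N + N + \sum_(l < nb i) (deg j l)%:Z * szc i l.
  have -> : \sum_(l < nb i) (deg j l)%:Z * szc i l =
    (A * \sum_(l < nb i) deg j l * sz (g b) l)%N%:Z -
    (B * \sum_(l < nb i) deg j l * sz (g a) l)%N%:Z.
    rewrite !big_distrr !(big_morph Posz PoszD (erefl _)) -sumrB.
    by apply: eq_bigr => l _; rewrite /szc /=; lia.
  have := balance (g a) j; have := balance (g b) j.
  rewrite !(growing_cap (@all_growing _ j)) // /szc /ctc /N /muc; nia.
have N0 : N = 0.
  apply/eqP; rewrite eq_le andbC -{1}(szc_sum ord0) sumr_ge0 //= leNgt.
  apply/negP => N_gt0.
  have muc0 : muc i0 j0 = 0 by rewrite /muc -/A -/B mulnC subrr.
  have sz0 : szc i0 j0 = 0 by rewrite szcE muc0 mulr0.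
  have := bal i0 j0; rewrite muc0 sz0 => E.
  suff : ctc i0 < N + N + \sum_(l < nb i0) (deg j0 l)%:Z * szc i0 l by lia.
  apply: (null_direction_rigid (mud := muc)) => //.
  - move=> i j; rewrite muc_ge0 szcE /=.
    by have := len_gt0 (g 0) j; have := muc_ge0 i j; nia.
  - rewrite sumrB -!(big_morph Posz PoszD (erefl _)) -!big_distrr /=.
    by rewrite !g_bal /N; lia.
have muc0 i (j : 'I_(nb i)) : (A * mu (g b) j 0 = B * mu (g a) j 0)%N.
  have /eqP : \sum_(j < nb i) szc i j = 0 by rewrite szc_sum.
  rewrite psumr_eq0 // => /allP/(_ j (mem_index_enum _)) /=.
  rewrite szcE mulf_eq0 => /orP[|]; first by have := len_gt0 (g 0) j; lia.
  by rewrite /muc; lia.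
have mu_prop i (j : 'I_(nb i)) k : (A * mu (g b) j k = B * mu (g a) j k)%N.
  have gr := @all_growing i j.
  rewrite (mu_flatE _ (g_bal b) (growing_large gr _)) //.
  rewrite (mu_flatE _ (g_bal a) (growing_large gr _)) //.
  by rewrite (growing_len b a gr) mulnCA muc0 mulnCA.
pose c := (B %/ gcdn A B)%N.
have gcd_gt0 : (0 < gcdn A B)%N by rewrite gcdn_gt0 A_gt0.
have : (c <= 1)%N.
  apply: (primitive (s := g b) seq_delta0) => i j k.
  rewrite /c -(Gauss_dvdr _ (n := (A %/ gcdn A B)%N)); last first.
    by rewrite coprime_sym /coprime -(eqn_pmul2r gcd_gt0) muln_gcdl
      !divnK ?dvdn_gcdl ?dvdn_gcdr // mul1n.
  rewrite -(dvdn_pmul2r gcd_gt0) divnK ?dvdn_gcdr //.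
  by rewrite mulnAC divnK ?dvdn_gcdl // mu_prop dvdn_mulr.
rewrite leqNgt => /negP; apply.
rewrite /c ltn_divRL ?dvdn_gcdr // mul1n.
by apply: leq_ltn_trans AB; apply: dvdn_leq => //; apply: dvdn_gcdl.
Qed.

End Sequence.

Local Close Scope ring_scope.

(** A sequence of data of increasing rank can be thinned out until all the
    parameters occurring in [seq_absurd] are constant or increasing. *)
Theorem rank_bounded : exists K, forall x, rk x <= K.
Proof.
have [//|no_bound] := pselect (exists K, forall x, rk x <= K).
have [t|f f_rk] := @choice _ _ (fun t x => t + delta < rk x).
  have /forallNP/(_ (t + delta)) := no_bound => /existsNP[x /negP].
  by rewrite -ltnNge => lt_x; exists x.
pose blk := {i : 'I_p.+1 & 'I_(nb i)}.
pose u (v : option (blk * 'I_3)) t :=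
  if v is Some (b, o) then
    if o == 0 :> nat then sz (f t) (tagged b)
    else if o == 1 :> nat then mu (f t) (tagged b) 0 else len (f t) (tagged b)
  else rk (f t).
have [h h_incr h_tame] := tame_subsequence_fin u.
exfalso; apply: (@seq_absurd (f \o h)).
- by move=> t /=; apply: balanced_large; apply: leq_ltn_trans (f_rk _); lia.
- move=> t /=; have := f_rk (h t); have := increasing_ge t h_incr; lia.
- by move=> s t; apply: (tame_le (h_tame None)).
- by move=> i j; apply: (h_tame (Some (Tagged _ j, @Ordinal 3 0 isT))).
- by move=> i j; apply: (h_tame (Some (Tagged _ j, @Ordinal 3 1 isT))).
- by move=> i j; apply: (h_tame (Some (Tagged _ j, @Ordinal 3 2 isT))).
Qed.

(** * The shape is bounded *)

Lemma codim_gt0 x i : i != ord0 -> 0 < codim x i.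
Proof.
move=> i_n0; have [j cap_j] := cap_attained x i; rewrite lt0n; apply/eqP => ct0.
have := balance x j; have := data_reduced x j i_n0; have := sz_le_rk x j.
by rewrite cap_j ct0; lia.
Qed.

Lemma nb_le_rk x i : nb i <= rk x.
Proof.
rewrite -(sz_sum x i) -[X in X <= _]card_ord -sum1_card.
by apply: leq_sum => j _; apply: sz_gt0.
Qed.

Lemma shape_bounded_small x N : rk x <= N ->
  [/\ p <= 2 * N ^ 2 + delta, forall i, nb i <= N &
      forall i (j j' : 'I_(nb i)), deg j j' <= 2 * N + 4 * N ^ 2 + 2 * delta].
Proof.
move=> le_N; have rk0 := rk_gt0 x; have := defect x.
set S := \sum_i codim x i; set T := bigop _ _ _ => def.
have S_le : S <= 2 * N ^ 2 + delta by nia.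
split=> [|i|i j j'].
- apply: leq_trans S_le; rewrite /S (bigD1 ord0) //=.
  have pE : \sum_(i < p.+1 | i != ord0) 1 = p by rewrite sum1_card cardC1 card_ord.
  by rewrite -{1}pE; apply: leq_trans (leq_addl _ _); apply: leq_sum => i /codim_gt0.
- exact: leq_trans (nb_le_rk x i) le_N.
have codim_le : codim x i <= S by rewrite /S (bigD1 i) //= leq_addr.
have cap_le : mu x j 0 * (cap x j - mu x j 0) <= T.
  rewrite /T (bigD1 i) //= (bigD1 j) //= (bigD1 (Ordinal rk0)) //=.
  by rewrite -!addnA leq_addr.
have := balance x j; rewrite (bigD1 j') //=.
have := sz_gt0 x j'; have := mu0_gt0 x j; have := sz_le_rk x j.
have := mu_le_sz x j 0; nia.
Qed.

Lemma sz_sum_uniq x i (j : 'I_(nb i)) : (forall j', j' = j) -> sz x j = rk x.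
Proof.
move=> uniq_j; rewrite -(sz_sum x i) (bigD1 j) //= big1 ?addn0 // => j'.
by rewrite (uniq_j j') eqxx.
Qed.

Lemma cap_le_sz x i (j : 'I_(nb i)) : balanced x -> cap x j <= sz x j + delta.
Proof.
move=> bx; have := cap_le bx (lt0n_neq0 (mu0_gt0 x j)).
by have := mu_le_sz x j 0; lia.
Qed.

(** If D_i < n / 2, the balance equation makes every block at i larger than
    n / 2, so there is only one block.  Its largest part is n - D_i > n / 2,
    and all its parts are equal, so that the normal form is scalar. *)
Lemma codim_scalar x i : balanced x -> delta.*2.+2 < rk x -> (codim x i).*2 < rk x ->
  i = ord0 /\ codim x i = 0.
Proof.
move=> bx rk_large codim_small.
have sz_large (j : 'I_(nb i)) : rk x < (sz x j).*2.
  by have := balance x j; have := cap_le_sz j bx; lia.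
have [j _] := block_exists x i.
have uniq_j j' : j' = j.
  apply/eqP/negPn/negP => ne; have := sz_sum x i.
  rewrite (bigD1 j) //= (bigD1 j') //=.
  by have := sz_large j; have := sz_large j'; lia.
have szj := sz_sum_uniq x uniq_j.
have := balance x j; rewrite big1 => [|j' _]; last first.
  by rewrite (uniq_j j') deg_diag.
rewrite szj cap_large ?szj //; last by lia.
move=> bal; have mu_large : delta.+1 < mu x j 0 by lia.
have muj : mu x j 0 = rk x.
  have := sz_flatE bx mu_large; rewrite szj.
  by case: (len x j) => [|[|l]]; nia.
split; last by lia.
by apply/eqP/negPn/negP => /(data_reduced x j); rewrite muj ltnn.
Qed.

Lemma p_le4 x : balanced x -> delta.*2.+2 < rk x -> p <= 4.
Proof.
move=> bx rk_large; have : p * rk x <= 4 * rk x.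
  have -> : p * rk x = \sum_(i < p.+1 | i != ord0) rk x.
    by rewrite sum_nat_const cardC1 card_ord.
  have -> : 4 * rk x = \sum_i 2 * codim x i.
    by rewrite -big_distrr /= bx; lia.
  rewrite [X in _ <= X](bigD1 ord0) //=; apply: leq_trans (leq_addl _ _).
  apply: leq_sum => i i_n0; rewrite mul2n leqNgt; apply/negP => /(codim_scalar bx rk_large).
  by case=> i0; rewrite i0 in i_n0.
by rewrite leq_pmul2r ?rk_gt0.
Qed.

(** Let E = 2 n - D_i, the sum of the other codims.  The balance equation
    bounds E + d_i(j,l) s_l by 2 s_j + delta for all j and l.  If E >= n / 2
    all blocks have size at least about n / 4.  Otherwise all the other codims
    are less than n / 2, so they vanish and E = 0.  Let j0 be a block of
    maximal size M and let d_i(j0, j1) > 0.  By transitivity every block j has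
    d_i(j, j0) > 0 or d_i(j, j1) > 0, which bounds its size from below by
    about M / 4, and bounds n from above by about 4 M. *)
Lemma nb_le40 x i : balanced x -> 100 * delta.+1 < rk x -> nb i <= 40.
Proof.
move=> bx rk_large.
have sum_const c : \sum_(j < nb i) c = nb i * c by rewrite sum_nat_const card_ord.
have codim_sum : codim x i + \sum_(i' | i' != i) codim x i' = (rk x).*2.
  by rewrite -bx [RHS](bigD1 i).
have key (j l : 'I_(nb i)) :
    (rk x).*2 - codim x i + deg j l * sz x l <= (sz x j).*2 + delta.
  have := balance x j; have := cap_le_sz j bx; rewrite (bigD1 l) //=.
  by set X := bigop _ _ _; lia.
have [E_large|E_small] := leqP (rk x) ((rk x).*2 - codim x i).*2.
  have : nb i * rk x <= 8 * rk x.
    rewrite -sum_const -{2}(sz_sum x i) big_distrr /=; apply: leq_sum => j _.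
    by have := key j j; lia.
  by rewrite leq_pmul2r ?rk_gt0 // => /leq_trans; apply.
have codim_i : codim x i = (rk x).*2.
  rewrite -codim_sum big1 ?addn0 // => i' i'_n.
  have le_E : codim x i' <= \sum_(i' | i' != i) codim x i'.
    by rewrite (bigD1 i') //= leq_addr.
  by have [||//] := @codim_scalar x i' bx; lia.
have bal (j : 'I_(nb i)) : sz x j + cap x j = \sum_(l < nb i) deg j l * sz x l.
  by have := balance x j; rewrite codim_i; lia.
have [l _] := block_exists x i.
pose j0 := [arg max_(j > l) sz x j]; pose M := sz x j0.
have M_max (j : 'I_(nb i)) : sz x j <= M.
  by rewrite /M /j0; case: arg_maxnP => // j1 _; apply.
have [j1 deg01] : exists j1, 0 < deg j0 j1.
  apply/existsP; rewrite -[[exists _, _]]negbK; apply/negP => /existsPn no.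
  have := bal j0; have := sz_gt0 x j0; rewrite big1 => [|j _]; first by lia.
  by have := no j; rewrite lt0n negbK => /eqP ->.
have deg_or j : 0 < deg j0 j \/ 0 < deg j1 j.
  case: (posnP (deg j0 j)) => [z|]; last by left.
  right; rewrite lt0n; apply/eqP => z1; move: deg01.
  by rewrite (deg_trans0 z) // deg_sym.
have M_le (j : 'I_(nb i)) : M <= 4 * sz x j + 3 * delta.
  have k01 := key j1 j0; rewrite deg_sym in k01.
  have := key j j0; have := key j j1; rewrite ![deg j _]deg_sym -/M in k01 *.
  by case: (deg_or j) => ?; nia.
have rk_le : rk x <= 4 * M + 2 * delta.
  have : rk x <= (sz x j0 + cap x j0) + (sz x j1 + cap x j1).
    rewrite !bal -(sz_sum x i) -big_split; apply: leq_sum => j _ /=.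
    by case: (deg_or j) => ?; nia.
  have := cap_le_sz j0 bx; have := cap_le_sz j1 bx; have := M_max j1.
  by rewrite -/M; lia.
have nbM : nb i * M <= 4 * rk x + nb i * (3 * delta).
  rewrite -!sum_const -(sz_sum x i) big_distrr -big_split /=.
  exact: leq_sum.
rewrite leqNgt; apply/negP => nb_large.
have M_large : 24 * delta.+1 <= M by lia.
have : 41 * (M - 3 * delta) <= nb i * (M - 3 * delta) by rewrite leq_mul2r nb_large orbT.
by rewrite [X in _ <= X]mulnBr; lia.
Qed.

(** Any bound serving both cases of [shape_bounded] would do: the square comes
    from ranks at most 100 (delta + 1), the constant 40 from larger ones. *)
Definition shape_bound (d : nat) :=
  4 * (100 * d.+1) ^ 2 + 2 * (100 * d.+1) + 2 * d + 40.

Theorem shape_bounded x :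
  [/\ p <= shape_bound delta, forall i, nb i <= shape_bound delta &
      forall i (j j' : 'I_(nb i)), deg j j' <= shape_bound delta].
Proof.
rewrite /shape_bound; have [small|large] := leqP (rk x) (100 * delta.+1).
  have [p_le nb_le deg_le] := shape_bounded_small small.
  split=> [|i|i j j']; first by lia.
    by have := nb_le i; lia.
  by have := deg_le i j j'; lia.
have bx : balanced x by apply: balanced_large; lia.
split=> [|i|i j j'].
- by have := p_le4 bx; lia.
- by have := nb_le40 i bx large; lia.
- by have := deg_le j j' bx; lia.
Qed.

End SpectralData.

(** * From numerical conditions to spectral data *)

(** Given the multiplicities, [codim] and [cap] are determined: the pairing
    hypothesis, applied to a choice of a cheapest block at each point, is the
    inequality sum_i D_i >= 2 n. *)
Lemma spectral_data_exists (p : nat) (nb : 'I_p.+1 -> nat)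
    (deg : forall i, 'I_(nb i) -> 'I_(nb i) -> nat) (delta n M : nat)
    (s : forall i, 'I_(nb i) -> nat) (m : forall i, 'I_(nb i) -> nat -> nat) :
  0 < n ->
  (forall i j, 0 < s i j) -> (forall i, \sum_j s i j = n) ->
  (forall i j k, m i j k.+1 <= m i j k) ->
  (forall i j k, M <= k -> m i j k = 0) ->
  (forall i j, \sum_(k < M) m i j k = s i j) ->
  (forall ji : forall i, 'I_(nb i), n.*2 <= \sum_i
     (n.*2 + \sum_j' deg i (ji i) j' * s i j' - (s i (ji i) + m i (ji i) 0))) ->
  \sum_i \sum_j (n.*2 * s i j + (\sum_j' deg i j j' * s i j') * s i j) =
  n * n.*2 + delta + \sum_i \sum_j (s i j * s i j + \sum_(k < M) m i j k * m i j k) ->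
  (forall i j, i != ord0 -> m i j 0 < n) ->
  (delta = 0 -> forall g, (forall i j k, g %| m i j k) -> g <= 1) ->
  exists x : spectral_data deg delta, mu x = m.
Proof.
move=> n_gt0 s_gt0 s_sum m_mono m_big m_sum pairing quad red prim.
pose W i (j : 'I_(nb i)) := \sum_j' deg i j j' * s i j'.
pose cost i (j : 'I_(nb i)) := n.*2 + W i j - (s i j + m i j 0).
have s_le i j : s i j <= n by rewrite -(s_sum i) (bigD1 j) //= leq_addr.
have m_le i j k l : k <= l -> m i j l <= m i j k.
  move/subnKC=> <-; elim: (l - k) => [|h IH]; first by rewrite addn0.
  by rewrite addnS; apply: leq_trans (m_mono _ _ _) IH.
have m0_le i j : m i j 0 <= s i j.
  rewrite -m_sum; case: {+}M m_sum m_big => [_ /(_ i j 0) -> //|M' _ _].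
  by rewrite big_ord_recl leq_addr.
have m_big_n i j k : n <= k -> m i j k = 0.
  move=> n_le; have [/(m_big i j) //|k_lt] := leqP M k.
  apply/eqP; rewrite -leqn0 leqNgt; apply/negP => m_pos.
  have : k.+1 <= \sum_(l < M) m i j l.
    have -> : k.+1 = \sum_(l < M) (l < k.+1) by rewrite sum_ltn; lia.
    apply: leq_sum => l _; case: ltnP => // l_le.
    by apply: leq_trans m_pos _; apply: m_le.
  by rewrite m_sum; have := s_le i j; lia.
have pick_min i : {j : 'I_(nb i) | forall j', cost i j <= cost i j'}.
  have nb_gt0 : 0 < nb i.
    rewrite lt0n; apply/eqP => nb0; have := s_sum i; rewrite big1; first by lia.
    by case=> j j_lt; exfalso; rewrite nb0 in j_lt.
  exists [arg min_(j < Ordinal nb_gt0) cost i j].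
  by case: arg_minnP => // j _ j_min j'; apply: j_min.
pose ji i := sval (pick_min i).
have ji_min i j : cost i (ji i) <= cost i j by rewrite /ji; case: (pick_min i).
pose codim i := cost i (ji i).
pose cap i j := m i j 0 + (cost i j - codim i).
have balance i j : s i j + cap i j + codim i = n.*2 + \sum_j' deg i j j' * s i j'.
  have := ji_min i j; have := s_le i j; have := m0_le i j.
  by rewrite /cap -/(codim i) /cost -/(W i j); lia.
have sumM i j (F : nat -> nat) : (forall k, m i j k = 0 -> F k = 0) ->
    \sum_(k < M) F k = \sum_(k < n) F k.
  by move=> F0; apply: big_ord_stable => k k_le; apply: F0;
    by [apply: m_big|apply: m_big_n].
have m_sum_n i j : \sum_(k < n) m i j k = s i j by rewrite -(sumM i j).
unshelve eexists (@SpectralData _ _ _ _ n s m codim cap _ _ _ _ _ _ _ _ _ _ _ _ _) => //.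
- by move=> i j; apply: leq_addr.
- by move=> i; exists (ji i); rewrite /cap /codim subnn addn0.
- exact: pairing.
apply: (@addIn (\sum_i \sum_j (s i j * s i j + \sum_(k < M) m i j k * m i j k))).
rewrite -quad big_distrr -!big_split /=; apply: eq_bigr => i _.
rewrite -{1}(s_sum i) big_distrl -!big_split /=; apply: eq_bigr => j _.
rewrite (sumM i j (fun k => m i j k * m i j k)) => [|k -> //].
have parts : \sum_(k < n) m i j k * (cap i j - m i j k) +
    \sum_(k < n) m i j k * m i j k = s i j * cap i j.
  rewrite -big_split -(m_sum_n i j) big_distrl; apply: eq_bigr => k _ /=.
  rewrite -mulnDr subnK //; apply: leq_trans (m_le i j 0 k (leq0n k)) _.
  exact: leq_addr.
move: parts (balance i j); rewrite -/(W i j); move: (bigop _ _ _) => P.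
move: (cap i j) (codim i) (W i j) (bigop _ _ _) => T c w S parts bal; nia.
Qed.

(** * The symmetric form in terms of multiplicities *)

Local Open Scope ring_scope.

Lemma leg_telescope (f g : nat -> int) M :
  \sum_(k < M) ((f k.+1 * g k.+1 - f k.+1 * g k) + (g k.+1 * f k.+1 - g k.+1 * f k)) =
  \sum_(k < M) (f k - f k.+1) * (g k - g k.+1) - f 0%N * g 0%N + f M * g M.
Proof.
elim: M => [|M IH]; first by rewrite !big_ord0; lia.
by rewrite !big_ord_recr /= IH; ring.
Qed.

Section TitsForm.
Context {R : realType} {n p : nat} {bl : 'I_p.+1 -> blocks n}.
Local Notation C := (cplx R).
Variables (B : forall i, @htl R n (bl i)).
Variable xi : forall i, 'I_(nb (bl i)) -> seq C.

Local Notation vertex := (vertex xi).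
Local Notation Q := (dquiver B xi).

(** The dimension vectors that occur are best described on the extended legs
    that start at the block itself: [f j 0] is the size of the block [j] and
    [f j k] the entry at the vertex [i,j,k].  This treats regular points, which
    have no vertex for their block, like the irregular ones. *)
Definition profile := forall i, 'I_(nb (bl i)) -> nat -> int.

Definition dimvec (f : profile) : {ffun vertex -> int} := [ffun v : vertex =>
  match v with
  | inl u => f _ (tagged (val u)) 0%N
  | inr u => f _ (tagged (tag u)) (tagged u).+1
  end].

Definition profile_of_rank (f : profile) (X : int) :=
  (forall i j k, (e_ xi j <= k)%N -> f i j k = 0) /\
  (forall i, \sum_j f i j 0%N = X).

Definition mult (f : profile) : profile := fun i j k => f i j k - f i j k.+1.

Lemma sum_irr_vertex (F : blk_index (bl := bl) -> int) :
  \sum_(u : irr_vertex (bl := bl)) F (val u) =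
  \sum_(i | irr (bl := bl) i) \sum_(j < nb (bl i)) F (Tagged (fun i => 'I_(nb (bl i))) j).
Proof.
rewrite -(big_sub (fun u : blk_index (bl := bl) => irr (bl := bl) (tag u)) F).
rewrite sig_big_dep /=; apply: eq_big => [u|[i j] _] //=.
by rewrite andbT.
Qed.

Lemma sum_leg_vertex (F : leg_vertex xi -> int) :
  \sum_u F u = \sum_i \sum_(j < nb (bl i)) \sum_(k < (e_ xi j).-1)
    F (Tagged (fun u : blk_index (bl := bl) => 'I_(e_ xi (tagged u)).-1)
        (k : 'I_(e_ xi (tagged (Tagged (fun i => 'I_(nb (bl i))) j))).-1)).
Proof.
pose G (u : blk_index (bl := bl)) := \sum_(k : 'I_(e_ xi (tagged u)).-1)
    F (Tagged (fun u : blk_index (bl := bl) => 'I_(e_ xi (tagged u)).-1) k).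
transitivity (\sum_u G u).
  by rewrite /G sig_big_dep /=; apply: eq_bigr => -[u k].
by rewrite [RHS]sig_big_dep /=; apply: eq_bigr => -[i j].
Qed.

Lemma irr0 : irr (bl := bl) ord0.
Proof. by rewrite /irr eqxx orbT. Qed.

Lemma reg_block_uniq i (j j' : 'I_(nb (bl i))) : ~~ irr (bl := bl) i -> j' = j.
Proof.
rewrite negb_or -leqNgt => /andP[nb1 _]; apply: val_inj.
by case: j j' => j j_lt [j' j'_lt] /=; lia.
Qed.

Definition updeg i (j j' : 'I_(nb (bl i))) : nat :=
  if (j < j')%N then htl_d (B i) j j' else 0%N.

Lemma arrows_from_irr (g : profile) Y (u : irr_vertex (bl := bl)) :
  profile_of_rank g Y ->
  \sum_w (qarr (q := Q) (inl u) w)%:Z * dimvec g w =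
  \sum_(j < nb (bl (tag (val u))))
    (updeg (tagged (val u)) j)%:Z * g _ j 0%N
  + (if tag (val u) == ord0 then
      \sum_(i | irr (bl := bl) i && (i != ord0)) Y else 0).
Proof.
move=> [_ gY]; rewrite big_sumType /= [X in _ + X]big1 ?addr0; last first.
  by move=> w _; rewrite mul0r.
case: u => [[i0 j0] irr_i0] /=.
pose F (w : blk_index (bl := bl)) :=
  (if i0 == tag w then
     if (j0 < tagged w)%N then
       htl_d (B i0) j0 (tagged_as (Tagged (fun i => 'I_(nb (bl i))) j0) w)
     else 0%N
   else i0 == ord0)%:Z * g _ (tagged w) 0%N.
transitivity (\sum_(w : irr_vertex (bl := bl)) F (val w)).
  by apply: eq_bigr => w _; rewrite ffunE.
rewrite sum_irr_vertex (bigD1 i0) //=; congr (_ + _).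
  apply: eq_bigr => j _; rewrite /F /= eqxx.
  by congr (_%:Z * _); rewrite tagged_asE.
have [i00|i0n] := boolP (i0 == ord0); last first.
  apply: big1 => i /andP[_ ne]; apply: big1 => j _.
  by rewrite /F /= eq_sym (negPf ne) (negPf i0n) mul0r.
apply: eq_big => [i|i /andP[_ ne]]; first by rewrite (eqP i00).
rewrite -(gY i); apply: eq_bigr => j _.
by rewrite /F /= i00 eq_sym (negPf ne) mul1r.
Qed.

(** An arrow out of a leg vertex leads to the preceding place of the extended
    leg.  At a regular point the first vertex is joined to all the blocks at
    infinity, whose total size is that of the single block there. *)
Lemma arrows_from_leg (g : profile) Y (u : leg_vertex xi) :
  profile_of_rank g Y ->
  \sum_w (qarr (q := Q) (inr u) w)%:Z * dimvec g w =
  g _ (tagged (tag u)) (tagged u).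
Proof.
move=> [_ gY]; rewrite big_sumType /=; case: u => [[i j] k] /=.
have [k0|k_gt0] := posnP k; last first.
  rewrite big1 ?add0r => [|w _]; last by rewrite mul0r.
  have k1_lt : (k.-1 < (e_ xi j).-1)%N by apply: leq_ltn_trans (leq_pred k) _.
  pose w0 : leg_vertex xi := @Tagged _
    (Tagged (fun i => 'I_(nb (bl i))) j)
    (fun u : blk_index (bl := bl) => 'I_(e_ xi (tagged u)).-1) (Ordinal k1_lt).
  rewrite (bigD1 w0) //= ffunE /= eqxx prednK // eqxx mul1r big1 ?addr0 //.
  move=> [t l] ne; rewrite ffunE /=; case: eqP => [tE|_]; last by rewrite mul0r.
  case: _ / tE l ne => l ne; case: eqP => [kE|_]; last by rewrite mul0r.
  case/eqP: ne; congr Tagged; apply: val_inj => /=.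
  by rewrite kE.
rewrite k0 /= [X in _ + X]big1 ?addr0; last first.
  by move=> w _; rewrite andbF mul0r.
pose F (w : blk_index (bl := bl)) :=
  (if irr (bl := bl) i then Tagged (fun i => 'I_(nb (bl i))) j == w
   else tag w == ord0)%:Z * g _ (tagged w) 0%N.
transitivity (\sum_(w : irr_vertex (bl := bl)) F (val w)).
  by apply: eq_bigr => w _; rewrite ffunE.
rewrite sum_irr_vertex; have [irr_i|reg_i] := boolP (irr (bl := bl) i).
  rewrite (bigD1 i) //= (bigD1 j) //= /F irr_i /= eqxx mul1r.
  rewrite big1 ?addr0 => [|j' ne]; last first.
    by rewrite -tag_eqE /tag_eq /= eqxx tagged_asE eq_sym (negPf ne) mul0r.
  rewrite big1 ?addr0 // => i' /andP[_ ne]; apply: big1 => j' _.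
  by rewrite -tag_eqE /tag_eq /= eq_sym (negPf ne) mul0r.
rewrite (bigD1 ord0) ?irr0 //= [X in _ + X]big1 ?addr0; last first.
  move=> i' /andP[_ ne]; apply: big1 => j' _.
  by rewrite /F (negPf reg_i) /= (negPf ne) mul0r.
transitivity Y.
  rewrite -(gY ord0); apply: eq_bigr => j' _.
  by rewrite /F (negPf reg_i) /= mul1r.
rewrite -(gY i) (bigD1 j) //= big1 ?addr0 // => j'.
by rewrite (reg_block_uniq j j' reg_i) eqxx.
Qed.

Lemma sum_legs (h : profile) M : (forall i (j : 'I_(nb (bl i))), (e_ xi j <= M)%N) ->
  (forall i j k, (e_ xi j <= k.+1)%N -> h i j k = 0) ->
  \sum_(u : leg_vertex xi) h _ (tagged (tag u)) (tagged u) =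
  \sum_i \sum_j \sum_(k < M) h i j k.
Proof.
move=> e_le h0; rewrite sum_leg_vertex /=.
apply: eq_bigr => i _; apply: eq_bigr => j _.
apply: (@big_ord_stable _ _ _ _ _ (h i j)) => k k_ge; apply: h0.
  by lia.
exact: leq_trans (e_le i j) (leqW k_ge).
Qed.

Lemma euler_dimvec (f g : profile) X Y M :
  profile_of_rank f X -> profile_of_rank g Y ->
  (forall i (j : 'I_(nb (bl i))), (e_ xi j <= M)%N) ->
  euler (Q := Q) (dimvec f) (dimvec g) =
  \sum_(i | irr (bl := bl) i) \sum_j f i j 0%N * g i j 0%N
  - \sum_(i | irr (bl := bl) i) \sum_j \sum_j'
      (updeg j j')%:Z * (f i j 0%N * g i j' 0%N)
  - \sum_(i | irr (bl := bl) i && (i != ord0)) X * Y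
  + \sum_i \sum_j \sum_(k < M) (f i j k.+1 * g i j k.+1 - f i j k.+1 * g i j k).
Proof.
move=> fX gY e_le; rewrite /euler.
have -> : \sum_v \sum_w (qarr (q := Q) v w)%:Z * (dimvec f v * dimvec g w) =
    \sum_v dimvec f v * \sum_w (qarr (q := Q) v w)%:Z * dimvec g w.
  apply: eq_bigr => v _; rewrite mulr_sumr; apply: eq_bigr => w _.
  by rewrite mulrCA.
rewrite !big_sumType /=.
under [X in _ - (X + _)]eq_bigr => u _ do rewrite (arrows_from_irr u gY) ffunE.
under [X in _ - (_ + X)]eq_bigr => u _ do rewrite (arrows_from_leg u gY) ffunE.
under [X in X + _ - _]eq_bigr => u _ do rewrite !ffunE.
under [X in _ + X - _]eq_bigr => u _ do rewrite !ffunE.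
rewrite (sum_irr_vertex (fun u => f _ (tagged u) 0%N * g _ (tagged u) 0%N)) /=.
rewrite (sum_irr_vertex (fun u => f _ (tagged u) 0%N *
  (\sum_(j < nb (bl (tag u)))
    (updeg (tagged u) j)%:Z * g _ j 0%N
  + (if tag u == ord0 then
      \sum_(i | irr (bl := bl) i && (i != ord0)) Y else 0)))) /=.
have leg1 : \sum_(u : leg_vertex xi) f _ (tagged (tag u)) (tagged u).+1 *
      g _ (tagged (tag u)) (tagged u).+1 -
    \sum_(u : leg_vertex xi) f _ (tagged (tag u)) (tagged u).+1 *
      g _ (tagged (tag u)) (tagged u) =
    \sum_i \sum_j \sum_(k < M) (f i j k.+1 * g i j k.+1 - f i j k.+1 * g i j k).
  rewrite -sumrB.
  apply: (sum_legs (h := fun i j k =>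
    f i j k.+1 * g i j k.+1 - f i j k.+1 * g i j k)) => // i j k k_ge.
  by rewrite fX.1 // !mul0r subrr.
rewrite -leg1.
have -> : \sum_(i | irr (bl := bl) i) \sum_j f i j 0%N *
   (\sum_(j' < nb (bl i)) (updeg j j')%:Z * g i j' 0%N
    + (if i == ord0 then \sum_(i | irr (bl := bl) i && (i != ord0)) Y else 0)) =
  \sum_(i | irr (bl := bl) i) \sum_j \sum_j'
      (updeg j j')%:Z * (f i j 0%N * g i j' 0%N)
  + \sum_(i | irr (bl := bl) i && (i != ord0)) X * Y.
  under eq_bigr => i _ do under eq_bigr => j _ do rewrite mulrDr.
  under eq_bigr => i _ do rewrite big_split /=.
  rewrite big_split /=; congr (_ + _).
    apply: eq_bigr => i _; apply: eq_bigr => j _; rewrite mulr_sumr.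
    by apply: eq_bigr => j' _; rewrite mulrCA.
  rewrite (bigD1 ord0) ?irr0 //= [X in _ + X]big1 ?addr0; last first.
    by move=> i /andP[_ /negPf ->]; apply: big1 => j _; rewrite mulr0.
  by rewrite -mulr_suml fX.2 mulr_sumr.
by ring.
Qed.

Lemma htl_d_diag i (j : 'I_(nb (bl i))) : htl_d (B i) j j = 0%N.
Proof. by rewrite /htl_d subrr size_poly0. Qed.

Lemma htl_d_sym i (j j' : 'I_(nb (bl i))) : htl_d (B i) j j' = htl_d (B i) j' j.
Proof. by rewrite /htl_d -opprB size_polyN. Qed.

Lemma htl_d_trans0 i (j j' j'' : 'I_(nb (bl i))) :
  htl_d (B i) j j' = 0%N -> htl_d (B i) j' j'' = 0%N -> htl_d (B i) j j'' = 0%N.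
Proof.
rewrite /htl_d; have -> : hq (B i) j - hq (B i) j'' =
  (hq (B i) j - hq (B i) j') + (hq (B i) j' - hq (B i) j'') by rewrite addrA subrK.
set P := hq _ _ - _; set P' := hq _ _ - _; have := size_polyD P P'; lia.
Qed.

Lemma updegD i (j j' : 'I_(nb (bl i))) :
  (updeg j j' + updeg j' j)%N = htl_d (B i) j j'.
Proof.
rewrite /updeg; case: ltngtP => [_|_|/val_inj ->]; rewrite ?addn0 ?add0n //.
  by rewrite htl_d_sym.
by rewrite htl_d_diag.
Qed.

(** Along a leg the form telescopes into the products of the multiplicities.
    A regular point has a single block, and a finite irregular one receives
    the arrows from infinity, which contribute - 2 X Y; so both contribute
    alike.  The point at infinity lacks this term, whence the leading
    2 X Y. *)
Lemma bil_dimvec (f g : profile) X Y M :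
  profile_of_rank f X -> profile_of_rank g Y ->
  (forall i (j : 'I_(nb (bl i))), (e_ xi j <= M)%N) ->
  bil (Q := Q) (dimvec f) (dimvec g) =
  X * Y *+ 2 - \sum_i \sum_j
    (X * g i j 0%N *+ 2 - f i j 0%N * g i j 0%N -
     \sum_(k < M) mult f j k * mult g j k +
     (\sum_j' (htl_d (B i) j j')%:Z * f i j' 0%N) * g i j 0%N).
Proof.
move=> fX gY e_le; rewrite /bil (euler_dimvec fX gY e_le) (euler_dimvec gY fX e_le).
pose a i := \sum_j f i j 0%N * g i j 0%N.
pose L i : int := \sum_(j < nb (bl i)) \sum_(k < M) mult f j k * mult g j k.
pose D i := \sum_j (\sum_j' (htl_d (B i) j j')%:Z * f i j' 0%N) * g i j 0%N.
have -> : \sum_i \sum_j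
    (X * g i j 0%N *+ 2 - f i j 0%N * g i j 0%N -
     \sum_(k < M) mult f j k * mult g j k +
     (\sum_j' (htl_d (B i) j j')%:Z * f i j' 0%N) * g i j 0%N) =
   \sum_i (X * Y *+ 2 - a i - L i + D i).
  apply: eq_bigr => i _; rewrite big_split !sumrB /=; congr (_ - _ - _ + _).
  by rewrite sumrMnl -mulr_sumr gY.2.
have -> : \sum_(i | irr (bl := bl) i) \sum_j g i j 0%N * f i j 0%N =
          \sum_(i | irr (bl := bl) i) a i.
  by apply: eq_bigr => i _; apply: eq_bigr => j _; rewrite mulrC.
have legs : \sum_i \sum_j \sum_(k < M) (f i j k.+1 * g i j k.+1 - f i j k.+1 * g i j k)
   + \sum_i \sum_j \sum_(k < M) (g i j k.+1 * f i j k.+1 - g i j k.+1 * f i j k)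
   = \sum_i (L i - a i).
  rewrite -big_split; apply: eq_bigr => i _ /=; rewrite -big_split -sumrB.
  apply: eq_bigr => j _ /=; rewrite -big_split /= leg_telescope.
  by rewrite (fX.1 i j M) // mul0r addr0.
have degs : \sum_(i | irr (bl := bl) i) \sum_j \sum_j'
      (updeg j j')%:Z * (f i j 0%N * g i j' 0%N) +
    \sum_(i | irr (bl := bl) i) \sum_j \sum_j'
      (updeg j j')%:Z * (g i j 0%N * f i j' 0%N) =
    \sum_(i | irr (bl := bl) i) D i.
  rewrite -big_split; apply: eq_bigr => i _ /=.
  rewrite [X in X + _]exchange_big -big_split; apply: eq_bigr => j _ /=.
  rewrite -big_split mulr_suml; apply: eq_bigr => j' _ /=.
  by rewrite -(updegD j j') PoszD; ring.
have -> : Y * X = X * Y by rewrite mulrC.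
transitivity (\sum_(i | irr (bl := bl) i) (a i *+ 2 - D i)
   - \sum_(i | irr (bl := bl) i && (i != ord0)) (X * Y *+ 2) + \sum_i (L i - a i)).
  by rewrite sumrB !sumrMnl -legs -degs; ring.
rewrite [X in X - _ + _]big_mkcond [X in _ - X + _]big_mkcond /=.
rewrite -sumrB -big_split /=.
rewrite [Z in _ = Z - _](_ : _ =
  \sum_(i < p.+1) (if i == ord0 then X * Y *+ 2 else 0)); last first.
  by rewrite -big_mkcond big_pred1_eq.
rewrite -sumrB; apply: eq_bigr => i _.
have [->|i_n0] := eqVneq i ord0; first by rewrite irr0 /=; ring.
rewrite andbT; case: ifP => [_|/negbT reg_i]; first by ring.
have DE : D i = 0.
  rewrite /D big1 // => j _; rewrite big1 ?mul0r // => j' _.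
  by rewrite (reg_block_uniq j j' reg_i) htl_d_diag mul0r.
have [j _|empty] := pickP (fun _ : 'I_(nb (bl i)) => true); last first.
  have X0 : X = 0 by rewrite -(fX.2 i) big1 // => j; have := empty j.
  have aE : a i = 0 by rewrite /a big1 // => j; have := empty j.
  by rewrite DE X0 aE; ring.
have fj : f i j 0%N = X.
  rewrite -(fX.2 i) (bigD1 j) //= big1 ?addr0 // => j'.
  by rewrite (reg_block_uniq j j' reg_i) eqxx.
have gj : g i j 0%N = Y.
  rewrite -(gY.2 i) (bigD1 j) //= big1 ?addr0 // => j'.
  by rewrite (reg_block_uniq j j' reg_i) eqxx.
have aE : a i = X * Y.
  rewrite /a (bigD1 j) //= big1 ?addr0 ?fj ?gj // => j'.
  by rewrite (reg_block_uniq j j' reg_i) eqxx.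
by rewrite DE aE; ring.
Qed.

End TitsForm.

(** * Divisible roots *)

Section DivisibleRoots.
Variable Q : quiver.
Local Notation dimv := {ffun qvert Q -> int}.
Implicit Types x y z : dimv.

Lemma euler_suml x y :
  euler x y = \sum_v x v * (y v - \sum_w (qarr v w)%:Z * y w).
Proof.
rewrite /euler -sumrB; apply: eq_bigr => v _; rewrite mulrBr mulr_sumr.
by congr (_ - _); apply: eq_bigr => w _; rewrite mulrCA.
Qed.

Lemma euler_sumr x y :
  euler x y = \sum_v (x v - \sum_w (qarr w v)%:Z * x w) * y v.
Proof.
rewrite /euler [X in _ - X]exchange_big -sumrB; apply: eq_bigr => v _.
rewrite mulrBl mulr_suml.
by congr (_ - _); apply: eq_bigr => w _; rewrite mulrA.
Qed.

Lemma eulerDl x y z : euler (x + y) z = euler x z + euler y z.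
Proof.
rewrite !euler_suml -big_split; apply: eq_bigr => v _.
by rewrite !ffunE mulrDl.
Qed.

Lemma eulerDr x y z : euler z (x + y) = euler z x + euler z y.
Proof.
rewrite !euler_sumr -big_split; apply: eq_bigr => v _.
by rewrite !ffunE mulrDr.
Qed.

Lemma bilDl x y z : bil (x + y) z = bil x z + bil y z.
Proof. by rewrite /bil eulerDl eulerDr; ring. Qed.

Lemma euler0l x : euler 0 x = 0.
Proof. by rewrite euler_suml big1 // => v _; rewrite ffunE mul0r. Qed.

Lemma euler0r x : euler x 0 = 0.
Proof. by rewrite euler_sumr big1 // => v _; rewrite ffunE mulr0. Qed.

Lemma eulerMnl x y g : euler (x *+ g) y = euler x y *+ g.
Proof.
by elim: g => [|g IH]; rewrite ?mulr0n ?euler0l // !mulrSr eulerDl IH.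
Qed.

Lemma eulerMnr x y g : euler x (y *+ g) = euler x y *+ g.
Proof.
by elim: g => [|g IH]; rewrite ?mulr0n ?euler0r // !mulrSr eulerDr IH.
Qed.

Lemma qformMn x g : qform (x *+ g) = qform x *+ (g * g).
Proof. by rewrite /qform eulerMnl eulerMnr mulrnA. Qed.

Lemma bilMnl x z g : bil (x *+ g) z = bil x z *+ g.
Proof. by rewrite /bil eulerMnl eulerMnr -mulrnDl. Qed.

Lemma bilNl x z : bil (- x) z = - bil x z.
Proof.
by apply: (addrI (bil x z)); rewrite -bilDl !subrr /bil euler0l euler0r.
Qed.

Lemma bilMzl x z c : bil (x *~ c) z = bil x z *~ c.
Proof.
by case: c => g; rewrite ?NegzE ?mulrNz ?bilNl -!pmulrn bilMnl.
Qed.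

Lemma bil_eps_loopfree (v : qvert Q) : loopfree v -> bil (eps v) (eps v) = 2.
Proof.
move=> lf; rewrite /bil; suff -> : euler (eps v) (eps v) = 1 by [].
have other w : w != v -> eps v w = 0 by rewrite ffunE => /negPf ->.
rewrite euler_suml (bigD1 v) //= [X in _ + X]big1 => [|w ne]; last by rewrite (other w ne) mul0r.
rewrite (bigD1 v) //= lf mul0r [X in 0 + X]big1 => [|w ne]; last by rewrite (other w ne) mulr0.
by rewrite ffunE eqxx.
Qed.

Lemma reflectionK (v : qvert Q) x : loopfree v -> reflection v (reflection v x) = x.
Proof.
move=> lf; rewrite /reflection bilDl bilNl bilMzl bil_eps_loopfree //.
set c := bil x _; rewrite -addrA -opprD -mulrzDr.
have -> : c - 2 *~ c = - c by rewrite mulrzz; lia.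
by rewrite subrr mulr0z subr0.
Qed.

Lemma reflectionMn (v : qvert Q) x g : reflection v (x *+ g) = reflection v x *+ g.
Proof. by rewrite /reflection bilMnl mulrnBl -[bil x _ *+ g]mulr_natr natz mulrzA. Qed.

(** Reflections are linear automorphisms of the root lattice, so they preserve
    divisibility by [g]. *)
Lemma weyl_orbit_divisible z x y g :
  weyl_orbit z x -> x = y *+ g -> exists2 z', z = z' *+ g & weyl_orbit z' y.
Proof.
move=> zx; elim: zx y => [y ->|w v _ IH lf y E]; first by exists y => //; left.
have [z' -> orb] : exists2 z', z = z' *+ g & weyl_orbit z' (reflection v y).
  by apply: IH; rewrite -reflectionMn -E reflectionK.
by exists z' => //; rewrite -(reflectionK y lf); right.
Qed.

Lemma ffunMn x g v : (x *+ g) v = x v *+ g.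
Proof. by elim: g => [|g IH]; rewrite ?mulr0n ?ffunE // !mulrSr ffunE IH. Qed.

Lemma fundamental_region_divisible z g : (0 < g)%N ->
  fundamental_region (z *+ g) -> fundamental_region z.
Proof.
move=> g_gt0 [nz nn conn neg].
have zg0 v : ((z *+ g) v != 0) = (z v != 0).
  by rewrite ffunMn mulrn_eq0 negb_or -lt0n g_gt0.
split.
- by apply: contraNneq nz => ->; rewrite mul0rn.
- by move=> v; have := nn v; rewrite ffunMn pmulrn_lge0.
- move=> v w vz wz; have := conn v w; rewrite !zg0 => /(_ vz wz).
  by congr (is_true _); apply: eq_connect => u u'; rewrite !zg0.
- by move=> v; have := neg v; rewrite bilMnl pmulrn_lle0.
Qed.

(** A real root is not divisible, since simple roots are not; for an imaginary
    root, divide the element of the fundamental region in its orbit. *)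
Lemma positive_root_divisible x g : (1 < g)%N ->
  positive_root (x *+ g) -> positive_root x.
Proof.
move=> g_gt1 [root nn]; have g_gt0 := ltnW g_gt1.
split; last by move=> v; have := nn v; rewrite ffunMn pmulrn_lge0.
case: root => [[v lf orb]|[z fz orb]].
  exfalso; have [e eE _] := weyl_orbit_divisible orb erefl.
  have := congr1 (fun h : dimv => h v) eE.
  rewrite /= ffunMn ffunE eqxx -mulr_natr -[_ *+ g]mulr_natr !natz.
  by move: (e v) => c; have [?|?] : (1 <= c \/ c <= 0) := ltac:(lia); nia.

have [z' zE orb'] : exists2 z', z = z' *+ g &
    weyl_orbit z' x \/ weyl_orbit z' (- x).
  case: orb => /weyl_orbit_divisible orb.
    by have [z' zE ?] := orb _ _ erefl; exists z' => //; left.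
  have [|z' zE ?] := orb (- x) g; first by rewrite mulNrn.
  by exists z' => //; right.
right; exists z' => //; apply: (@fundamental_region_divisible _ g) => //.
by rewrite -zE.
Qed.

End DivisibleRoots.

(** * Dimension vectors of fundamental families *)

Section RootData.
Context {R : realType} {n p : nat} {bl : 'I_p.+1 -> blocks n}.
Local Notation C := (cplx R).
Variables (B : forall i, @htl R n (bl i)).
Variable xi : forall i, 'I_(nb (bl i)) -> seq C.
Local Notation Q := (dquiver B xi).

Lemma alpha_leg0 i (j : 'I_(nb (bl i))) : alpha_leg B xi j 0 = bsize j.
Proof. by rewrite /alpha_leg take0 /xi_prod big_nil mxrank1. Qed.

Lemma alpha_leg_le i (j : 'I_(nb (bl i))) k :
  (alpha_leg B xi j k.+1 <= alpha_leg B xi j k)%N.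
Proof.
rewrite /alpha_leg; have [k_lt|k_ge] := ltnP k (size (xi j)); last first.
  by rewrite !take_oversize // ltnW.
rewrite (take_nth 0) // /xi_prod -cats1 big_cat /=.
exact: mxrankM_maxl.
Qed.

Lemma alpha_leg_big i (j : 'I_(nb (bl i))) k : xi_admissible B xi ->
  (e_ xi j <= k)%N -> alpha_leg B xi j k = 0%N.
Proof.
move=> adm e_le; rewrite /alpha_leg take_oversize //.
by have [-> _] := adm i j; rewrite mxrank0.
Qed.

Lemma e_gt0 i (j : 'I_(nb (bl i))) : xi_admissible B xi -> (0 < e_ xi j)%N.
Proof.
move=> adm; rewrite lt0n; apply/eqP => e0; have := bsize_gt0 j.
by rewrite -alpha_leg0 alpha_leg_big // e0.
Qed.

Lemma e_scalar i (j : 'I_(nb (bl i))) : xi_admissible B xi ->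
  alpha_leg B xi j 1 = 0%N -> e_ xi j = 1%N.
Proof.
move=> adm /eqP; rewrite mxrank_eq0 => /eqP rank0; apply/eqP.
rewrite eqn_leq e_gt0 // andbT; have [_ /(_ _ rank0) le1] := adm i j.
by apply: leq_trans le1 _; rewrite size_take; case: ifP => // /negbT; lia.
Qed.

Definition alpha_profile : profile (bl := bl) := fun i j k => (alpha_leg B xi j k)%:Z.

Lemma alphaE : alpha B xi = dimvec xi alpha_profile.
Proof. by apply/ffunP => -[u|u]; rewrite !ffunE // /alpha_profile alpha_leg0. Qed.

Lemma alpha_profileP : xi_admissible B xi -> profile_of_rank xi alpha_profile n%:Z.
Proof.
move=> adm; split=> [i j k e_le|i]; first by rewrite /alpha_profile alpha_leg_big.
transitivity (\sum_(j < nb (bl i)) bsize j)%N%:Z; last by rewrite bsize_sum.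
rewrite (big_morph Posz PoszD (erefl _)).
by apply: eq_bigr => j _; rewrite /alpha_profile alpha_leg0.
Qed.

(** The profiles of the test vectors in the definition of F-tilde; that of a
    leg vertex has block sizes zero. *)
Definition choice_profile (ji : forall i, 'I_(nb (bl i))) : profile (bl := bl) :=
  fun i j k => ((k == 0%N) && (j == ji i))%:R.

Lemma eps_JE ji : eps_J xi ji = dimvec xi (choice_profile ji).
Proof. by apply/ffunP => -[u|u]; rewrite !ffunE. Qed.

Lemma choice_profileP ji : xi_admissible B xi ->
  profile_of_rank xi (choice_profile ji) 1.
Proof.
move=> adm; split=> [i j k e_le|i].
  by rewrite /choice_profile; have := e_gt0 j adm; case: k e_le => //; lia.
rewrite (bigD1 (ji i)) //= /choice_profile /= eqxx big1 ?addr0 // => j /negPf ->.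
by [].
Qed.

Definition leg_profile (u : leg_vertex xi) : profile (bl := bl) :=
  fun i j k => ((Tagged (fun i => 'I_(nb (bl i))) j == tag u) &&
                (k == (tagged u).+1))%:R.

Lemma eps_legE u : eps (Q := Q) (inr u) = dimvec xi (leg_profile u).
Proof.
apply/ffunP => -[v|v]; rewrite !ffunE; first by rewrite /leg_profile andbF.
rewrite /leg_profile (_ : inr v == inr u = (v == u)) //.
case: u v => [t k] [t' k'] /=.
have -> : Tagged (fun i => 'I_(nb (bl i))) (tagged t') = t' by case: t' k'.
case: (t' =P t) k => [E|ne] k; last first.
  by case: eqP => // /(congr1 tag).
by case: _ / E k => k; rewrite eq_Tagged eqSS.
Qed.

Lemma leg_profileP u : profile_of_rank xi (leg_profile u) 0.
Proof.
split=> [i j k e_le|i]; last by rewrite big1 // => j _; rewrite /leg_profile andbF.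
rewrite /leg_profile; case: u => [t l] /=; case: eqP l => //= E.
by case: _ / E => l; case: eqP => //; have := ltn_ord l; rewrite /=; lia.
Qed.

Definition xi_size_bound : nat := \max_(u : blk_index (bl := bl)) e_ xi (tagged u).

Lemma e_le_bound i (j : 'I_(nb (bl i))) : (e_ xi j <= xi_size_bound)%N.
Proof.
exact: (leq_bigmax (F := fun u : blk_index (bl := bl) => e_ xi (tagged u))
          (Tagged (fun i => 'I_(nb (bl i))) j)).
Qed.

Lemma sum_indicator (M c : nat) (F : nat -> int) :
  (c < M)%N -> \sum_(k < M) F k * (k == c :> nat)%:R = F c.
Proof.
move=> c_lt; rewrite (bigD1 (Ordinal c_lt)) //= eqxx mulr1 big1 ?addr0 // => k.
by rewrite -val_eqE /= => /negPf ->; rewrite mulr0.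
Qed.

Definition alpha_mult i (j : 'I_(nb (bl i))) (k : nat) : nat :=
  (alpha_leg B xi j k - alpha_leg B xi j k.+1)%N.

Lemma mult_alphaE i (j : 'I_(nb (bl i))) k :
  mult alpha_profile j k = (alpha_mult j k)%:Z.
Proof. by rewrite /mult /alpha_profile /alpha_mult; have := alpha_leg_le j k; lia. Qed.

Hypothesis adm : xi_admissible B xi.
Local Notation M := xi_size_bound.

Lemma alpha_mult_big i (j : 'I_(nb (bl i))) k : (M <= k)%N -> alpha_mult j k = 0%N.
Proof.
move=> k_ge; rewrite /alpha_mult alpha_leg_big //.
exact: leq_trans (e_le_bound j) k_ge.
Qed.

Lemma alpha_mult_sum_from i (j : 'I_(nb (bl i))) k :
  (\sum_(l < M) alpha_mult j (k + l) = alpha_leg B xi j k)%N.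
Proof.
have part N : (\sum_(l < N) alpha_mult j (k + l) + alpha_leg B xi j (k + N) =
    alpha_leg B xi j k)%N.
  elim: N => [|N IH]; first by rewrite big_ord0 addn0.
  rewrite big_ord_recr /= -addnA /alpha_mult addnS subnK ?alpha_leg_le //.
rewrite -[RHS](part M) (@alpha_leg_big _ _ (k + M)) ?addn0 //.
exact: leq_trans (e_le_bound j) (leq_addl _ _).
Qed.

Lemma alpha_mult_sum i (j : 'I_(nb (bl i))) :
  (\sum_(k < M) alpha_mult j k = bsize j)%N.
Proof. by rewrite -alpha_leg0 -(alpha_mult_sum_from j 0). Qed.

Lemma bil_alpha_leg u : bil (Q := Q) (alpha B xi) (eps (Q := Q) (inr u)) =
  (alpha_mult (tagged (tag u)) (tagged u).+1)%:Z
  - (alpha_mult (tagged (tag u)) (tagged u))%:Z.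
Proof.
rewrite alphaE eps_legE (bil_dimvec B (alpha_profileP adm) (leg_profileP u) e_le_bound).
rewrite mulr0 mul0rn sub0r -sumrN.
have leg0 i (j : 'I_(nb (bl i))) : leg_profile u j 0 = 0.
  by rewrite /leg_profile andbF.
rewrite (eq_bigr (fun i => \sum_(j < nb (bl i))
    \sum_(k < M) mult alpha_profile j k * mult (leg_profile u) j k)); last first.
  move=> i _; rewrite -sumrN; apply: eq_bigr => j _.
  by rewrite leg0 !mulr0 mul0rn subrr sub0r addr0 opprK.
case: u leg0 => [[i j] k] _ /=; rewrite (bigD1 i) //= (bigD1 j) //=.
have k_lt : (k.+1 < M)%N.
  by have := ltn_ord k; have := e_le_bound j; rewrite /=; lia.
rewrite [X in _ + X + _]big1 ?addr0 => [|j' ne]; last first.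
  apply: big1 => l _; rewrite /mult /leg_profile /= -tag_eqE /tag_eq /=.
  by rewrite eqxx tagged_asE (negPf ne) subrr mulr0.
rewrite [X in _ + X]big1 ?addr0 => [|i' ne]; last first.
  apply: big1 => j' _; apply: big1 => l _; rewrite /mult /leg_profile /=.
  by rewrite -tag_eqE /tag_eq /= (negPf ne) subrr mulr0.
rewrite -(sum_indicator (fun k => (alpha_mult j k)%:Z) k_lt).
rewrite -(sum_indicator (fun k => (alpha_mult j k)%:Z) (ltnW k_lt)) -sumrB.
apply: eq_bigr => l _; rewrite mult_alphaE /mult /leg_profile /= eqxx /= eqSS.
by rewrite mulrBr.
Qed.

Lemma alpha_mult_mono i (j : 'I_(nb (bl i))) k :
  (forall u, bil (Q := Q) (alpha B xi) (eps (Q := Q) (inr u)) <= 0) ->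
  (alpha_mult j k.+1 <= alpha_mult j k)%N.
Proof.
move=> neg; have [k_lt|k_ge] := ltnP k (e_ xi j).-1; last first.
  by rewrite /alpha_mult (@alpha_leg_big _ _ k.+1) //; have := e_gt0 j adm; lia.
pose u : leg_vertex xi := @Tagged _ (Tagged (fun i => 'I_(nb (bl i))) j)
  (fun u : blk_index (bl := bl) => 'I_(e_ xi (tagged u)).-1) (Ordinal k_lt).
by have := neg u; rewrite bil_alpha_leg /=; lia.
Qed.

Local Notation W j := (\sum_j' htl_d (B _) j j' * bsize j')%N.

Lemma bil_alpha_choice ji : bil (Q := Q) (alpha B xi) (eps_J xi ji) =
  n%:Z *+ 2 - \sum_i (n%:Z *+ 2 + (W (ji i))%:Z
     - ((bsize (ji i))%:Z + (alpha_mult (ji i) 0)%:Z)).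
Proof.
rewrite alphaE eps_JE.
rewrite (bil_dimvec B (alpha_profileP adm) (choice_profileP ji adm) e_le_bound).
rewrite mulr1; congr (_ - _); apply: eq_bigr => i _.
rewrite (bigD1 (ji i)) //= [X in _ + X = _]big1 ?addr0 => [|j ne]; last first.
  rewrite /choice_profile (negPf ne) /= !mulr0 mul0rn big1 ?subrr ?addr0 // => k _.
  by rewrite /mult /choice_profile (negPf ne) !andbF subrr mulr0.
have M_gt0 : (0 < M)%N by apply: leq_trans (e_gt0 (ji i) adm) (e_le_bound _).
rewrite -(sum_indicator (fun k => (alpha_mult (ji i) k)%:Z) M_gt0).
rewrite (eq_bigr (fun k : 'I_M => (alpha_mult (ji i) k)%:Z * (k == 0%N :> nat)%:R));
  last first.
  by move=> k _; rewrite mult_alphaE /mult /choice_profile eqxx !andbT subr0.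
have -> : choice_profile ji (ji i) 0 = 1 by rewrite /choice_profile /= eqxx.
rewrite !mulr1 {1}/alpha_profile alpha_leg0.
rewrite (eq_bigr (fun j' => (htl_d (B i) (ji i) j' * bsize j')%N%:Z)); last first.
  by move=> j' _; rewrite /alpha_profile alpha_leg0.
by rewrite -(big_morph Posz PoszD (erefl _)) !mulr2n; ring.
Qed.

Lemma bil_alpha_alpha : bil (Q := Q) (alpha B xi) (alpha B xi) =
  (n * n)%N%:Z *+ 2
  + (\sum_i \sum_(j < nb (bl i)) (bsize j * bsize j
        + \sum_(k < M) alpha_mult j k * alpha_mult j k))%N%:Z
  - (\sum_i \sum_(j < nb (bl i)) (n.*2 * bsize j + W j * bsize j))%N%:Z.
Proof.
rewrite alphaE.
rewrite (bil_dimvec B (alpha_profileP adm) (alpha_profileP adm) e_le_bound).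
set S := (X in _ = _ + X%:Z - _); set T := (X in _ = _ + _ - X%:Z).
set U := (X in _ - X = _).
suff -> : U = T%:Z - S%:Z by rewrite PoszM; ring.
rewrite /U /S /T {U S T}.
rewrite !(big_morph Posz PoszD (erefl _)) -sumrB; apply: eq_bigr => i _.
rewrite !(big_morph Posz PoszD (erefl _)) -sumrB; apply: eq_bigr => j _.
rewrite /alpha_profile alpha_leg0.
rewrite (eq_bigr (fun k : 'I_M => (alpha_mult j k * alpha_mult j k)%N%:Z)); last first.
  by move=> k _; rewrite mult_alphaE PoszM.
rewrite (eq_bigr (fun j' => (htl_d (B i) j j' * bsize j')%N%:Z)); last first.
  by move=> j' _; rewrite alpha_leg0 PoszM.
by rewrite -!(big_morph Posz PoszD (erefl _)) !mulr2n -addnn !(PoszD, PoszM); ring.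
Qed.

(** If x = g y with g > 1, then q(y) = 0, and the decomposition of x into g
    copies of y has sum of p equal to g > 1 = p(x). *)
Lemma Sigma_primitive (x : {ffun vertex xi -> int}) (g : nat) :
  Sigma_dif B x -> qform (Q := Q) x = 0 -> (forall v, (g %| x v)%Z) -> (g <= 1)%N.
Proof.
move=> [[[inL nn] root lam0] noSigma] q0 dvd; rewrite leqNgt; apply/negP => g_gt1.
have g_gt0 := ltnW g_gt1; have gz : g%:Z != 0 by lia.
pose y : {ffun vertex xi -> int} := [ffun v => (x v %/ g)%Z].
have xE : x = y *+ g.
  apply/ffunP => v; rewrite (ffunMn (Q := Q)) ffunE -mulr_natr natz.
  by rewrite divzK.
have xEv v : x v = y v * g by rewrite xE (ffunMn (Q := Q)) -mulr_natr natz.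
have cand : candidate B y.
  split.
  - split=> [i irr_i i_n0|v]; last by have := nn v; rewrite xEv pmulr_lge0.
    have := inL i irr_i i_n0; rewrite /irr_sum.
    under eq_bigr => u _ do rewrite xEv.
    under [RHS]eq_bigr => u _ do rewrite xEv.
    by rewrite -!mulr_suml => /(mulIf gz).
  - by apply: (positive_root_divisible (Q := Q) g_gt1); rewrite -xE.
  - have := lam0; rewrite /dot_lambda.
    under eq_bigr => v _ do rewrite xEv intrM mulrAC.
    by rewrite -mulr_suml => /eqP; rewrite mulf_eq0 intr_eq0 => /orP[/eqP //|]; lia.
have qy : qform (Q := Q) y = 0.
  have := q0; rewrite xE qformMn => /eqP; rewrite mulrn_eq0 => /orP[|/eqP //].
  by lia.
have cands z : z \in nseq g y -> candidate B z.
  by rewrite mem_nseq => /andP[_ /eqP ->].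
have := noSigma (nseq g y); rewrite size_nseq => /(_ g_gt1 cands).
rewrite !big_nseq !iter_addr_0 => /(_ xE).
by rewrite /pfun q0 qy subr0 -mulr_natr natz mul1r; lia.
Qed.

End RootData.

(** * Finiteness *)

(** Here the three parts of the definition of fundamental are used:
    F-tilde gives the inequalities, Sigma the primitivity for delta = 0, and
    reducedness the absence of scalar normal forms at finite points. *)
Lemma fundamental_root_data (R : realType) (n p : nat) (bl : 'I_p.+1 -> blocks n)
    (B : forall i, @htl R n (bl i)) (xi : forall i, 'I_(nb (bl i)) -> seq (cplx R))
    (d : nat) :
  (0 < n)%N -> (1 < d)%N -> xi_admissible B xi -> fundamental B xi ->
  dimension B xi = d%:Z ->
  exists x : spectral_data (fun i j j' => htl_d (B i) j j') (d - 2),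
    mu x = @alpha_mult R n p bl B xi.
Proof.
move=> n_gt0 d_gt1 adm [[_ _ _ negJ neg_leg] sigma red] dimE.
have s_le i (j : 'I_(nb (bl i))) : (bsize j <= n)%N.
  by rewrite -{2}(bsize_sum (bl i)) (bigD1 j) //= leq_addr.
have m0_le i (j : 'I_(nb (bl i))) : (alpha_mult B xi j 0 <= bsize j)%N.
  by rewrite /alpha_mult alpha_leg0 leq_subr.
have qE : bil (Q := dquiver B xi) (alpha B xi) (alpha B xi) = - (d - 2)%N%:Z.
  by rewrite bilxx; move: dimE; rewrite /dimension /pfun !mulr2n; lia.
apply: (spectral_data_exists (n := n) (M := xi_size_bound xi)
          (s := fun i (j : 'I_(nb (bl i))) => bsize j)) => //.
- by move=> i j; apply: bsize_gt0.
- by move=> i; apply: bsize_sum.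
- by move=> i j k; apply: alpha_mult_mono.
- by move=> i j k; apply: alpha_mult_big.
- by move=> i j; apply: alpha_mult_sum.
- move=> ji; have := negJ ji; rewrite bil_alpha_choice // -lez_nat.
  rewrite (big_morph Posz PoszD (erefl _)) subr_le0 -addnn PoszD mulr2n.
  move=> /le_trans; apply; rewrite le_eqVlt; apply/orP; left; apply/eqP.
  apply: eq_bigr => i _; have := s_le i (ji i); have := m0_le i (ji i).
  by rewrite ?mulr2n; set w := bigop _ _ _; lia.
- have := bil_alpha_alpha adm; rewrite qE mulr2n.
  by set S := bigop _ _ _; set T := bigop _ _ _; lia.
- move=> i j i_n0; rewrite ltnNge; apply/negP => m_ge; apply: red.
  have sn : bsize j = n by have := s_le i j; have := m0_le i j; lia.
  exists i; split=> //; exists j; split=> [|j' ne|].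
  + by rewrite -lt0n bsize_gt0.
  + have := bsize_sum (bl i); rewrite (bigD1 j) //= (bigD1 j') //= sn; lia.
  + apply: e_scalar => //; move: m_ge; rewrite /alpha_mult alpha_leg0 sn.
    by have := alpha_leg_le B xi j 0; rewrite alpha_leg0 sn; lia.
move=> delta0 g dvd; apply: (Sigma_primitive sigma).
  by move: qE; rewrite bilxx delta0 mulr2n; lia.
have dvd_leg i (j : 'I_(nb (bl i))) k : (g %| alpha_leg B xi j k)%N.
  by rewrite -(alpha_mult_sum_from adm); apply: dvdn_sum => l _; apply: dvd.
case=> u; rewrite ffunE; last by apply: dvd_leg.
by rewrite -(alpha_leg0 B xi); apply: dvd_leg.
Qed.

Local Open Scope classical_set_scope.

(** Bounded functions on a finite type are finitely many, and [decode] absorbs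
    the dependent types of the objects they encode. *)
Lemma finite_set_coded (I : finType) (K : nat) (A : Type)
    (decode : (I -> nat) -> A) (S : set A) :
  (forall a, S a -> exists2 f : I -> nat, forall i, (f i <= K)%N & decode f = a) ->
  finite_set S.
Proof.
move=> cover.
apply: (@sub_finite_set _ _ ((fun f : {ffun I -> 'I_K.+1} =>
    decode (fun i => f i : nat)) @` setT)).
  move=> a /cover[f f_le <-]; exists [ffun i => inord (f i)] => //.
  by congr decode; apply/funext => i; rewrite ffunE inordK // ltnS.
by apply: finite_image; apply: finite_finset.
Qed.

Definition class_of p (nb : 'I_p.+1 -> nat)
    (deg : forall i, 'I_(nb i) -> 'I_(nb i) -> nat)
    (m : forall i, 'I_(nb i) -> nat -> nat) : set spectral_type :=
  [set s | spectral_equiv (@SpectralType p nb (fun i j k => (m i j k)%:Z) deg) s].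

Lemma finite_classes p (nb : 'I_p.+1 -> nat)
    (deg : forall i, 'I_(nb i) -> 'I_(nb i) -> nat) (delta : nat) :
  (forall i j j', deg i j j' = deg i j' j) ->
  (forall i j j' j'', deg i j j' = 0%N -> deg i j' j'' = 0%N -> deg i j j'' = 0%N) ->
  finite_set [set class_of deg (mu x) | x in [set: spectral_data deg delta]].
Proof.
move=> sym trans0; have [K K_bound] := rank_bounded delta sym trans0.
pose I : finType := ({i : 'I_p.+1 & 'I_(nb i)} * 'I_K)%type.
pose decode (f : I -> nat) := class_of deg (fun i j k =>
  if insub k is Some k' then f (Tagged (fun i => 'I_(nb i)) j, k') else 0%N).
apply: (@finite_set_coded I K _ decode) => _ [x _ <-].
exists (fun u : I => mu x (tagged u.1) u.2) => [u|].
  by apply: leq_trans (mu_le_sz x _ _) _; apply: leq_trans (sz_le_rk x _) _.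
congr class_of; apply: functional_extensionality_dep => i.
apply/funext => j; apply/funext => k.
case: insubP => [k' _ <- //|]; rewrite -leqNgt => k_ge.
by rewrite mu_big //; apply: leq_trans (K_bound x) _.
Qed.

Theorem theorem2p25 (R : realType) (d : nat) (hd_gt0 : (0 < d)%N)
  (hd_even : ~~ odd d) : finite_set (fundamental_spectral_types R d).
Proof.
have d_gt1 : (1 < d)%N by case: d hd_gt0 hd_even => [|[|]].
pose delta := (d - 2)%N; pose K := shape_bound delta.
pose shapes p : set ('I_p.+1 -> nat) := [set nb | forall i, (nb i <= K)%N].
pose degrees p (nb : 'I_p.+1 -> nat) : set (forall i, 'I_(nb i) -> 'I_(nb i) -> nat) :=
  [set deg | [/\ forall i j j', (deg i j j' <= K)%N, forall i j j', deg i j j' = deg i j' j &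
    forall i j j' j'', deg i j j' = 0%N -> deg i j' j'' = 0%N -> deg i j j'' = 0%N]].
apply: (@sub_finite_set _ _ (\bigcup_(p in `I_K.+1) \bigcup_(nb in shapes p)
    \bigcup_(deg in degrees p nb)
      [set class_of deg (mu x) | x in [set: spectral_data deg delta]])).
  move=> S [F [t [xi [adm_F _ adm fund [dimE ->]]]]].
  have n_gt0 : (0 < fn F)%N by case: adm_F.
  have [x mu_x] := fundamental_root_data n_gt0 d_gt1 adm fund dimE.
  have diag i j := @htl_d_diag R _ _ _ (fB t) i j.
  have sym i j j' := @htl_d_sym R _ _ _ (fB t) i j j'.
  have trans0 i j j' j'' := @htl_d_trans0 R _ _ _ (fB t) i j j' j''.
  have [p_le nb_le deg_le] := shape_bounded diag sym trans0 x.
  exists (fp F); first by rewrite /= ltnS.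
  exists (fun i => nb (fbl i)) => //.
  exists (fun i j j' => htl_d (fB t i) j j') => //.
  exists x => //; rewrite /class_of; congr (fun T => [set s | spectral_equiv T s]).
  rewrite /spectral_type_of mu_x; congr SpectralType.
  apply: functional_extensionality_dep => i; apply/funext => j; apply/funext => k.
  by rewrite /alpha_mult; have := alpha_leg_le (fB t) xi j k; lia.
apply: bigcup_finite => [|p _]; first exact: finite_II.
apply: bigcup_finite => [|nb _].
  by apply: (@finite_set_coded 'I_p.+1 K _ id) => nb nb_le; exists nb.
apply: bigcup_finite => [|deg [_ sym trans0]]; last exact: finite_classes.
pose I : finType := {i : 'I_p.+1 & ('I_(nb i) * 'I_(nb i))%type}.
pose decode (f : I -> nat) := fun i (j j' : 'I_(nb i)) =>
  f (Tagged (fun i => ('I_(nb i) * 'I_(nb i))%type) (j, j')).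
apply: (@finite_set_coded I K _ decode) => deg [deg_le _ _].
by exists (fun u : I => deg (tag u) (tagged u).1 (tagged u).2).
Qed.
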